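(* Let $\mathbf K_2$ be the class of right-angled Coxeter groups whose Coxeter graph is isomorphic to a graph $\Gamma_B$ as defined in the context, for some model $B$ of $Th(\mathbb N,\sigma,0)$. Then $(\mathbf K_2,\preccurlyeq)$ is tame.
   Context: Let $C^*$ be the graph with vertices $s,s',t_0,t_1,t_2,t_3$ and edges $t_0t_2,t_2t_3,t_3t_1,t_1t_0,t_0s,st_2,t_1s',s't_3,ss'$. Let $\sigma$ be the successor function. Every model $B$ of $Th(\mathbb N,\sigma,0)$ is the disjoint union of its standard part $\mathbb N$ ($n=\sigma^n(0)$) and some number of copies $Z$ of $\mathbb Z$ on which $\sigma$ is $+1$; in each copy fix $0_Z$. $\Gamma_B$ is the graph on $C^*\sqcup B$ whose edges are exactly: edges of $C^*$; $t_0,t_2$ to every even $n\in\mathbb N$; $t_1$ to $2$ and every odd $n$; $t_3$ to every odd $n$; $n$ to $n+1$ ($n\in\mathbb N$); $b$ to $b+1$ within each $Z$; $0_Z\pm n$ to every $m\in\mathbb N$ with $m\le n$; $t_3$ to $0_Z,0_Z\pm1$. A right-angled Coxeter group has a presentation with generating set $S$ (Coxeter basis) and only relations $s^2=e$, $(ss')^2=e$ for some pairs of distinct $s,s'$; its Coxeter graph has vertex set $S$, distinct vertices adjacent iff they commute. $A\preccurlyeq B$ iff $A$ is a subgroup of $B$ and some Coxeter basis $S$ of $B$ has $A\cap S$ a Coxeter basis of $A$. $(\mathbf K_2,\preccurlyeq)$ is an abstract elementary class with amalgamation, joint embedding, arbitrarily large models and Löwenheim–Skolem number $\omega$; $\mathfrak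 M$ is its monster model; $tp(a/A)=tp(b/A)$ iff some automorphism of $\mathfrak M$ fixing $A$ pointwise maps $a$ to $b$. Tame: for every $\lambda\ge\omega$, every $B\in\mathbf K_2$ of cardinality $\lambda$ with $B\preccurlyeq\mathfrak M$ and finite tuples $a,b$ with $tp(a/B)\ne tp(b/B)$, there is a countable $A\preccurlyeq B$ with $tp(a/A)\ne tp(b/A)$.
   Formalization: Amalgamation fails for these graphs (conjugating 0 by 2 is an automorphism of the group of ℕ that blocks it), so the monster model is taken to be universal and strongly homogeneous only over those submodels that are amalgamation bases. *)

(* Defs.v *)
From HB Require Import structures.
From mathcomp Require Import all_boot.
From mathcomp Require Import boolp classical_sets functions cardinality.

Set Implicit Arguments.
Unset Strict Implicit.
Unset Printing Implicit Defensive.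

Local Open Scope classical_set_scope.
Local Open Scope card_scope.

(** * First-order theory of the successor function *)

(* Formulas are in de Bruijn style: [All p] binds variable 0 of [p]. *)
Inductive term := Var of nat | Zero | Succ of term.

Inductive formula :=
  | Eq of term & term
  | Fls
  | Imp of formula & formula
  | All of formula.

Fixpoint term_below (k : nat) (t : term) : bool :=
  match t with
  | Var i => i < k
  | Zero => true
  | Succ u => term_below k u
  end.

Fixpoint formula_below (k : nat) (p : formula) : bool :=
  match p with
  | Eq t u => term_below k t && term_below k u
  | Fls => true
  | Imp p q => formula_below k p && formula_below k q
  | All p => formula_below k.+1 p
  end.

Definition sentence (p : formula) : bool := formula_below 0 p.

Record sstruct := SStruct { dom :> Type; szero : dom; ssucc : dom -> dom }.

Definition nat_sstruct : sstruct := @SStruct nat 0 S.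

Fixpoint teval (B : sstruct) (e : nat -> B) (t : term) : B :=
  match t with
  | Var i => e i
  | Zero => szero B
  | Succ u => ssucc (teval e u)
  end.

Definition env_cons (T : Type) (x : T) (e : nat -> T) (i : nat) : T :=
  if i is j.+1 then e j else x.

Fixpoint holds (B : sstruct) (e : nat -> B) (p : formula) : Prop :=
  match p with
  | Eq t u => teval e t = teval e u
  | Fls => False
  | Imp p q => holds e p -> holds e q
  | All p => forall x : B, holds (env_cons x e) p
  end.

Definition satisfies (B : sstruct) (p : formula) : Prop :=
  forall e : nat -> B, holds e p.

Definition Th (A : sstruct) : set formula :=
  [set p | sentence p /\ satisfies A p].

Definition models (B : sstruct) (T : set formula) : Prop :=
  forall p, T p -> satisfies B p.

(** * The graphs Gamma_B *)

Record graph := Graph { vertex : Type; edge : vertex -> vertex -> Prop }.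

Inductive Cvertex := vs | vs' | t0 | t1 | t2 | t3.

Inductive Carc : Cvertex -> Cvertex -> Prop :=
  | Carc02 : Carc t0 t2
  | Carc23 : Carc t2 t3
  | Carc31 : Carc t3 t1
  | Carc10 : Carc t1 t0
  | Carc0s : Carc t0 vs
  | Carcs2 : Carc vs t2
  | Carc1s' : Carc t1 vs'
  | Carcs'3 : Carc vs' t3
  | Carcss' : Carc vs vs'.

Definition std (B : sstruct) (n : nat) : B := iter n (@ssucc B) (szero B).

Definition standard (B : sstruct) : set B := range (@std B).

(* [at_dist o n b] is b = o + n or b = o - n inside a copy of Z. *)
Definition at_dist (B : sstruct) (o : B) (n : nat) (b : B) : Prop :=
  b = iter n (@ssucc B) o \/ iter n (@ssucc B) b = o.

(* A choice of an origin 0_Z in each copy Z of the integers; the copies are the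
   classes of nonstandard elements at finite distance from one another. *)
Definition is_origins (B : sstruct) (O : set B) : Prop :=
  O `<=` ~` @standard B /\
  forall b : B, ~ standard b -> exists! o : B, O o /\ exists n, at_dist o n b.

(* Each edge of Gamma_B is listed in (at least) one of its two directions. *)
Inductive Gamma_arc (B : sstruct) (O : set B) :
    Cvertex + B -> Cvertex + B -> Prop :=
  | arcC c d : Carc c d -> Gamma_arc O (inl c) (inl d)
  | arc_t0 n : ~~ odd n -> Gamma_arc O (inl t0) (inr (std B n))
  | arc_t2 n : ~~ odd n -> Gamma_arc O (inl t2) (inr (std B n))
  | arc_t1_2 : Gamma_arc O (inl t1) (inr (std B 2))
  | arc_t1 n : odd n -> Gamma_arc O (inl t1) (inr (std B n))
  | arc_t3 n : odd n -> Gamma_arc O (inl t3) (inr (std B n))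
  | arc_std n : Gamma_arc O (inr (std B n)) (inr (std B n.+1))
  | arc_Z b : ~ standard b -> Gamma_arc O (inr b) (inr (ssucc b))
  | arc_Z_std o n b m :
      O o -> at_dist o n b -> m <= n -> Gamma_arc O (inr b) (inr (std B m))
  | arc_t3_Z o n b :
      O o -> at_dist o n b -> n <= 1 -> Gamma_arc O (inl t3) (inr b).

Definition Gamma (B : sstruct) (O : set B) : graph :=
  @Graph (Cvertex + B)%type
    (fun x y => Gamma_arc O x y \/ Gamma_arc O y x).

(** * Group presentations and right-angled Coxeter groups *)

Local Open Scope group_scope.

(* A letter (x, true) stands for x, and (x, false) for its formal inverse. *)
Definition word (G : Type) := seq (G * bool).

Definition word_on (G : Type) (S : set G) : set (word G) :=
  [set w | foldr (fun l P => S l.1 /\ P) True w].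

Definition word_eval (G : groupType) (w : word G) : G :=
  foldr (fun l x => (if l.2 then l.1 else l.1^-1) * x) 1 w.

(* Equality in the group with generators S and relators R. *)
Inductive pres_eq (G : Type) (S : set G) (R : set (word G)) :
    word G -> word G -> Prop :=
  | pres_refl w : pres_eq S R w w
  | pres_sym v w : pres_eq S R v w -> pres_eq S R w v
  | pres_trans u v w : pres_eq S R u v -> pres_eq S R v w -> pres_eq S R u w
  | pres_cancel u v x b : word_on S u -> word_on S v -> S x ->
      pres_eq S R (u ++ (x, b) :: (x, ~~ b) :: v) (u ++ v)
  | pres_rel u v r : word_on S u -> word_on S v -> R r ->
      pres_eq S R (u ++ r ++ v) (u ++ v).

(* The subset H of G is a subgroup with presentation < S | R >. *)
Definition has_presentation (G : groupType) (H S : set G) (R : set (word G)) :=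
  H = (@word_eval G) @` word_on S /\
  forall w, word_on S w -> (word_eval w = 1 <-> pres_eq S R w [::]).

Inductive Coxeter_relator (G : Type) (S : set G) (E : G -> G -> Prop) :
    set (word G) :=
  | relator_sq s : S s -> Coxeter_relator S E [:: (s, true); (s, true)]
  | relator_comm s s' : S s -> S s' -> s <> s' -> E s s' ->
      Coxeter_relator S E [:: (s, true); (s', true); (s, true); (s', true)].

Definition Coxeter_basis (G : groupType) (H S : set G) : Prop :=
  exists E : G -> G -> Prop, has_presentation H S (Coxeter_relator S E).

Definition Coxeter_graph (G : groupType) (S : set G) : graph :=
  @Graph {x : G | S x}
    (fun x y => sval x <> sval y /\ commute (sval x) (sval y)).

Definition graph_iso (X Y : graph) : Prop :=
  exists f : vertex X -> vertex Y,
    bijective f /\ forall x y, edge x y <-> edge (f x) (f y).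

Definition subgroup (G : groupType) (A : set G) : Prop :=
  [/\ A 1, forall x y, A x -> A y -> A (x * y) & forall x, A x -> A x^-1].

Definition preceq (G : groupType) (A B : set G) : Prop :=
  [/\ subgroup A, subgroup B, A `<=` B &
    exists S : set G, Coxeter_basis B S /\ Coxeter_basis A (A `&` S)].

(** * Monster models, Galois types and tameness *)

(* A class of groups, as a property of subgroups of ambient groups; a group G
   itself is the subgroup [set: G]. *)
Definition group_class := forall G : groupType, set G -> Prop.

Definition K2 : group_class := fun G H =>
  subgroup H /\ exists S : set G, Coxeter_basis H S /\
    exists (B : sstruct) (O : set B),
      [/\ models B (Th nat_sstruct), is_origins O &
          graph_iso (Coxeter_graph S) (Gamma O)].

Section AbstractClass.
Variable K : group_class.

Definition submodel (G : groupType) (A B : set G) : Prop :=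
  [/\ K A, K B & preceq A B].

Definition morph_on (G H : groupType) (A : set G) (f : G -> H) : Prop :=
  forall x y, A x -> A y -> f (x * y) = f x * f y.

(* Values of f outside A are irrelevant. *)
Definition strong_embedding (G H : groupType) (A : set G) (f : G -> H) : Prop :=
  [/\ K A, morph_on A f, set_inj A f & submodel (f @` A) [set: H]].

Definition automorphism (G : groupType) (f : G -> G) : Prop :=
  bijective f /\ {morph f : x y / x * y}.

Definition amalgamation_base (G : groupType) (A : set G) : Prop :=
  forall (N1 N2 : groupType) (f1 : G -> N1) (f2 : G -> N2),
    strong_embedding A f1 -> strong_embedding A f2 ->
    exists (N : groupType) (g1 : N1 -> N) (g2 : N2 -> N),
      [/\ strong_embedding [set: N1] g1, strong_embedding [set: N2] g2 &
          forall x, A x -> g1 (f1 x) = g2 (f2 x)].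

Definition universal (M : groupType) : Prop :=
  forall N : groupType, K [set: N] -> [set: N] #<= [set: M] ->
    exists f : N -> M, strong_embedding [set: N] f.

(* Under the amalgamation property every member of K is an amalgamation base,
   and this is the usual strong model-homogeneity. Without the restriction to
   amalgamation bases, two extensions of A no larger than a universal M would
   amalgamate over A inside M, which is false for K2 when A is the group
   of the standard model (conjugating the generator 0 by the generator
   2 and fixing the other generators is an automorphism of that group, but the
   commutation of 0 with an origin 0_Z obstructs its extension). *)
Definition strongly_homogeneous (M : groupType) : Prop :=
  forall (A A' : set M) (f : M -> M),
    submodel A [set: M] -> submodel A' [set: M] ->
    ~ ([set: M] #<= A) -> amalgamation_base A ->
    set_bij A A' f -> morph_on A f ->
    exists F : M -> M, automorphism F /\ forall x, A x -> F x = f x.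

Definition monster (M : groupType) : Prop :=
  [/\ K [set: M], universal M & strongly_homogeneous M].

Definition same_type (M : groupType) (A : set M) (a b : seq M) : Prop :=
  exists F : M -> M,
    [/\ automorphism F, forall x, A x -> F x = x & map F a = b].

(* The cardinal lambda >= omega is that of the infinite set B; it ranges over
   all infinite cardinals as M ranges over all monster models. *)
Definition tame : Prop :=
  forall M : groupType, monster M ->
  forall B : set M, infinite_set B -> submodel B [set: M] ->
  forall a b : seq M, ~ same_type B a b ->
    exists A : set M, [/\ countable A, submodel A B & ~ same_type A a b].

End AbstractClass.

(* Main.v *)
(** If [B] is countable, take [A = B].  Otherwise let [I] index the copies of
    [Z] in a model for the monster [M].  First, [M] and [B] are rigid enough: the
    classes of involutions in the largest elementary abelian 2-quotient determine
    the Coxeter graph, so the basis witnessing [B] in [M] again has graph Gamma,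
    and since [B] is uncountable its part in [B] consists of the standard part
    together with full copies of [Z].  Let [A] be generated by the standard part
    and infinitely, but countably, many of these copies, including all those
    occurring in [a] and [b]; back-and-forth shows that [A] is in [K2].

    An automorphism [F] fixing the standard part maps each copy into the subgroup
    generated by the standard part and a single copy: the image of [0_Z + n]
    commutes with [0], [3] and [n], hence involves only letters of level at least
    [n]; being an involution, it is conjugate to the product of a clique, and
    centralizers confine all these images to one conjugate [g W g^-1], where
    retracting onto the levels beyond those of [g] removes [g].  So [F] permutes
    the copies.  Keeping [F] on the finitely many copies outside [B] that occur
    in [a], and permuting the others, gives an automorphism that fixes [B] and
    still maps [a] to [b]. *)

(* If [s] and [y] commute and every neighbour of [s] commutes with [y], the transvection taking [s]
   to [s * y] is an automorphism, so generators need not be recoverable modulo squares. In these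
   graphs this happens exactly when [s] has level 2 in a copy and [y] is the number 1; rigidity is
   proved with room for that single exception.

   The bases certifying membership in the class are unrelated to the basis witnessing [B] in [M].
   Rigidity moves both graph structures onto the latter, so the inclusion becomes an induced
   embedding of graphs. Uncountability makes [t3] and the numbers recognizable, as the only vertices
   of uncountable degree, and the edge from [t1] to 2 prevents the embedding from shifting the
   numbers.

   Infinitely many copies are kept in [A] because successor models with infinitely many copies
   compare by a back-and-forth that matches whole copies, with no bookkeeping of quantifier depth.
   Letters of different copies never commute, so a map may follow [F] on some copies and a
   permutation on the others and still respect all relations. *)
From mathcomp Require Import all_boot ssralg ssrnum ssrint zify.
From mathcomp Require Import boolp classical_sets functions cardinality.
Require Import Defs.

Set Implicit Arguments.
Unset Strict Implicit.
Unset Printing Implicit Defensive.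

Local Open Scope classical_set_scope.
Local Open Scope group_scope.

(** * Right-angled Coxeter groups *)

Section Products.
Variable G : groupType.
Implicit Types (S X Y : set G) (l m : seq G).

Definition prodl l : G := foldr (fun x y => x * y) 1 l.
Definition letters S l := forall x, x \in l -> S x.
Definition span S : set G := [set g | exists2 l, letters S l & g = prodl l].

Lemma prodl_cat l m : prodl (l ++ m) = prodl l * prodl m.
Proof. by elim: l => [|x l IH] /=; rewrite ?mul1g // IH mulgA. Qed.

Lemma letters_nil S : letters S [::].
Proof. by []. Qed.

Lemma letters_consP S x l : letters S (x :: l) <-> S x /\ letters S l.
Proof.
split=> [h|[hx h] y]; last by rewrite in_cons => /orP[/eqP->|/h].
by split=> [|y yl]; apply: h; rewrite ?mem_head // in_cons yl orbT.
Qed.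

Lemma letters_cat S l m : letters S l -> letters S m -> letters S (l ++ m).
Proof. by move=> hl hm x; rewrite mem_cat => /orP[/hl|/hm]. Qed.

Lemma letters_rev S l : letters S l -> letters S (rev l).
Proof. by move=> h x; rewrite mem_rev => /h. Qed.

Lemma letters_sub S X l : S `<=` X -> letters S l -> letters X l.
Proof. by move=> sub h x /h /sub. Qed.

Lemma span1 S : span S 1.
Proof. by exists [::]. Qed.

Lemma span_gen S x : S x -> span S x.
Proof.
move=> h; exists [:: x]; last by rewrite /= mulg1.
exact/letters_consP.
Qed.

Lemma spanM S x y : span S x -> span S y -> span S (x * y).
Proof.
move=> [l hl ->] [m hm ->]; exists (l ++ m); last by rewrite prodl_cat.
exact: letters_cat.
Qed.

Lemma span_prodl S l : letters S l -> span S (prodl l).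
Proof. by move=> h; exists l. Qed.

Lemma span_sub S X : S `<=` X -> span S `<=` span X.
Proof. by move=> sub g [l hl ->]; exists l => //; apply: letters_sub hl. Qed.

Lemma prodl_rev S l : (forall s, S s -> s * s = 1) -> letters S l ->
  prodl (rev l) = (prodl l)^-1.
Proof.
move=> sq; elim: l => [_|x l IH /letters_consP[Sx hl]]; first by rewrite /= invg1.
by rewrite rev_cons -cats1 prodl_cat IH //= mulg1 invgM (mulg1_eq (sq x Sx)).
Qed.

Lemma prodl_commute l g : (forall x, x \in l -> commute g x) ->
  commute g (prodl l).
Proof.
elim: l => [|x l IH] h; first exact: commute1.
apply: commuteM; first by apply: h; rewrite mem_head.
by apply: IH => y yl; apply: h; rewrite in_cons yl orbT.
Qed.

Lemma prodl_rem l x : {in l &, forall y z, commute y z} -> x \in l ->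
  prodl l = x * prodl (rem x l).
Proof.
elim: l => [//|y l IH] h; rewrite in_cons eq_sym /=.
case: (eqVneq y x) => [-> //|ne] /= xl.
have cxy : commute x y by apply: h; rewrite ?mem_head // in_cons xl orbT.
rewrite IH //; first by rewrite !mulgA cxy.
by move=> a b al bl; apply: h; rewrite in_cons ?al ?bl orbT.
Qed.

Lemma span_commute X g h : span X h -> (forall x, X x -> commute g x) ->
  commute g h.
Proof. by move=> [l hl ->] c; apply: prodl_commute => x /hl /c. Qed.

End Products.

(* Right-angled Coxeter systems through their universal property: an action of
   the generators that respects the relations is an action of the group. *)
Record racg (G : groupType) (S : set G) : Prop := Racg {
  racg_sq : forall s, S s -> s * s = 1;
  racg_act : forall (X : Type) (a : G -> X -> X),
    (forall s x, S s -> a s (a s x) = x) ->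
    (forall s t x, S s -> S t -> commute s t -> a s (a t x) = a t (a s x)) ->
    forall l m, letters S l -> letters S m -> prodl l = prodl m ->
    forall x, foldr a x l = foldr a x m }.

Lemma word_onP (G : groupType) (S : set G) (w : word G) :
  word_on S w <-> letters S (map fst w).
Proof.
elim: w => [|x w IH] /=; first by split.
by split=> [[h /IH h']|/letters_consP[h /IH]//]; apply/letters_consP.
Qed.

Section Basis.
Variables (G : groupType) (H S : set G).
Hypothesis basisS : Coxeter_basis H S.

Lemma Coxeter_basis_sq s : S s -> s * s = 1.
Proof.
case: basisS => E [_ pE] Ss.
have := pE [:: (s, true); (s, true)]; rewrite /= mulg1 => h.
apply/h; first by split.
by apply: (@pres_rel _ _ _ [::] [::] [:: (s, true); (s, true)]) => //; constructor.
Qed.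

Lemma word_eval_prodl w : word_on S w -> word_eval w = prodl (map fst w).
Proof.
elim: w => [//|[x b] w IH] /= [Sx /IH <-]; case: b => //.
by rewrite (mulg1_eq (Coxeter_basis_sq Sx)).
Qed.

Lemma pres_eq_act E (X : Type) (a : G -> X -> X) :
  (forall s x, S s -> a s (a s x) = x) ->
  (forall s t x, S s -> S t -> E s t -> a s (a t x) = a t (a s x)) ->
  forall u v, pres_eq S (Coxeter_relator S E) u v ->
  forall x, foldr a x (map fst u) = foldr a x (map fst v).
Proof.
move=> aK aC u v; elim=> {u v}.
- by [].
- by move=> v w _ IH x; rewrite IH.
- by move=> u v w _ IH _ IH' x; rewrite IH.
- by move=> u v x b _ _ Sx y; rewrite !map_cat /= !foldr_cat /= aK.
- move=> u v r _ _ [s Ss|s t Ss St _ Est] y;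
    rewrite !map_cat !foldr_cat /= ?aK //.
  by rewrite aC // aK // -/(foldr a y (map fst v)) aK.
Qed.

Lemma Coxeter_basis_racg : racg S /\ H = span S.
Proof.
have sq := Coxeter_basis_sq; have rv l := @prodl_rev G S l sq; have ev := word_eval_prodl.
case: basisS => E [HE pE].
have wordl l : letters S l -> word_on S [seq (x, true) | x <- l] /\
    word_eval [seq (x, true) | x <- l] = prodl l.
  move=> hl; have e : [seq i.1 | i <- [seq (x, true) | x <- l]] = l.
    by rewrite -map_comp; apply: map_id.
  have h : word_on S [seq (x, true) | x <- l] by apply/word_onP; rewrite e.
  by split=> //; rewrite ev // e.
have comE s t : S s -> S t -> s <> t -> E s t -> commute s t.
  move=> Ss St ne Est; have := pE [:: (s, true); (t, true); (s, true); (t, true)].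
  rewrite /= mulg1 => h; have : s * (t * (s * t)) = 1.
    apply/h; first by [].
    apply: (@pres_rel _ _ _ [::] [::]
      [:: (s, true); (t, true); (s, true); (t, true)]) => //.
    exact: relator_comm.
  rewrite mulgA => /mulg1_eq; rewrite invgM.
  by rewrite (mulg1_eq (sq _ Ss)) (mulg1_eq (sq _ St)).
split; last first.
  rewrite HE; apply/seteqP; split=> [g [w hw <-]|g [l hl ->]].
    by rewrite ev //; apply/span_prodl/word_onP.
  by have [h1 h2] := wordl l hl; exists [seq (x, true) | x <- l].
split=> // X a aK aC l m hl hm e x.
have aC' s t y : S s -> S t -> E s t -> a s (a t y) = a t (a s y).
  move=> Ss St Est; have [->//|ne] := pselect (s = t).
  exact/aC/comE.
have hlm : letters S (l ++ rev m) by apply: letters_cat (letters_rev _).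
have [h1 h2] := wordl _ hlm.
have : pres_eq S (Coxeter_relator S E) [seq (x, true) | x <- l ++ rev m] [::].
  by apply/pE => //; rewrite h2 prodl_cat rv // e mulgV.
move=> /(pres_eq_act aK aC') /(_ (foldr a x m)).
have -> : [seq i.1 | i <- [seq (x, true) | x <- l ++ rev m]] = l ++ rev m.
  by rewrite -map_comp; apply: map_id.
rewrite foldr_cat => /= <-; congr foldr.
elim: m x hm {e hlm h1 h2} => [//|y m IH] x /letters_consP[Sy hm].
by rewrite rev_cons -cats1 foldr_cat /= aK //; apply: IH.
Qed.

End Basis.

(** Deleting the letters outside [X] turns each relator into the empty word or a relator over [X],
    so a derivation over [S] becomes one over [X]. This is how special subgroups inherit their
    presentation. *)
Lemma pres_eq_filter (G : Type) (S X : set G) (E : G -> G -> Prop) u v :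
  X `<=` S ->
  pres_eq S (Coxeter_relator S E) u v ->
  pres_eq X (Coxeter_relator X E) [seq x <- u | `[<X x.1>]]
    [seq x <- v | `[<X x.1>]].
Proof.
move=> sub; have wX w : word_on X [seq x <- w | `[<X x.1>]].
  by elim: w => [//|x w IH] /=; case: asboolP.
elim=> {u v}.
- by move=> w; constructor.
- by move=> v w _; apply: pres_sym.
- by move=> u v w _ h1 _ h2; apply: pres_trans h1 h2.
- move=> u v x b _ _ Sx; rewrite !filter_cat /=.
  by case: asboolP => Xx; [apply: pres_cancel|constructor].
- move=> u v r _ _ hr; rewrite !filter_cat; case: hr => [s Ss|s t Ss St ne Est] /=.
    case: asboolP => Xs; last by constructor.
    by apply: (@pres_rel _ _ _ _ _ [:: (s, true); (s, true)]) => //; constructor.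
  case: asboolP => Xs; case: asboolP => Xt; last 1 first.
  + by constructor.
  + apply: (@pres_rel _ _ _ _ _
      [:: (s, true); (t, true); (s, true); (t, true)]) => //.
    exact: relator_comm.
  + by apply: (@pres_rel _ _ _ _ _ [:: (s, true); (s, true)]) => //; constructor.
  + by apply: (@pres_rel _ _ _ _ _ [:: (t, true); (t, true)]) => //; constructor.
Qed.

Lemma Coxeter_basis_sub (G : groupType) (H S X : set G) :
  Coxeter_basis H S -> X `<=` S -> Coxeter_basis (span X) X.
Proof.
move=> bS sub; have ev := word_eval_prodl bS; case: (bS) => E [HE pE].
have wX w : word_on X w -> word_on S w.
  by move=> /word_onP h; apply/word_onP; apply: letters_sub h.
exists E; split.
  apply/seteqP; split=> [g [l hl ->]|g [w hw <-]].
    have e : [seq i.1 | i <- [seq (x, true) | x <- l]] = l.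
      by rewrite -map_comp; apply: map_id.
    have hw : word_on X [seq (x, true) | x <- l] by apply/word_onP; rewrite e.
    by exists [seq (x, true) | x <- l] => //; rewrite ev ?e //; apply: wX.
  by rewrite (ev _ (wX _ hw)); apply/span_prodl/word_onP.
move=> w hw; split=> [e|h].
  have -> : w = [seq x <- w | `[<X x.1>]].
    elim: w hw {e} => [//|x w IH] /= [Xx hw].
    by case: asboolP => // _; rewrite -IH.
  by apply: (pres_eq_filter (v := [::]) sub); apply/pE => //; apply: wX.
apply/pE; first exact: wX.
elim: h => {w hw}.
- by constructor.
- by move=> ? ? _; apply: pres_sym.
- by move=> ? ? ? _ h _; apply: pres_trans h.
- by move=> u v x b hu hv Xx; apply: pres_cancel; auto.
- move=> u v r hu hv hr; apply: pres_rel; auto.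
  by case: hr => [s /sub|s t /sub ? /sub]; constructor.
Qed.

(** * Special subgroups, retractions, parities and the exchange condition *)

Section Theory.
Variables (G : groupType) (S : set G).
Hypothesis racgS : racg S.
Let sq := racg_sq racgS.

Lemma racg_inv s : S s -> s^-1 = s.
Proof. by move=> Ss; apply: mulg1_eq; apply: sq. Qed.

Lemma spanV X g : X `<=` S -> span X g -> span X g^-1.
Proof.
move=> sub [l hl ->]; exists (rev l); first exact: letters_rev.
by rewrite (prodl_rev sq) //; apply: letters_sub hl.
Qed.

(** An arbitrary word for [g]. Functions on the group are defined below by letting this word act; by
    [racg_act] the choice is immaterial. *)
Definition wd (g : G) : seq G := xget [::] [set l | letters S l /\ prodl l = g].

Lemma wdP g : span S g -> letters S (wd g) /\ prodl (wd g) = g.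
Proof.
move=> [l hl e]; rewrite /wd; case: xgetP => [m _ //|/(_ l)]; case.
by split.
Qed.

Lemma wd_act (X : Type) (a : G -> X -> X) :
  (forall s x, S s -> a s (a s x) = x) ->
  (forall s t x, S s -> S t -> commute s t -> a s (a t x) = a t (a s x)) ->
  forall l, letters S l -> forall x, foldr a x (wd (prodl l)) = foldr a x l.
Proof.
move=> aK aC l hl x; have [h1 h2] := wdP (span_prodl hl).
exact: (racg_act racgS).
Qed.

(** Words act on [G'] by left multiplication by the [f s]; the homomorphism is the orbit map of
    1. *)
Lemma racg_hom (G' : groupType) (f : G -> G') :
  (forall s, S s -> f s * f s = 1) ->
  (forall s t, S s -> S t -> commute s t -> commute (f s) (f t)) ->
  exists2 F : G -> G',
    forall x y, span S x -> span S y -> F (x * y) = F x * F y &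
    forall s, S s -> F s = f s.
Proof.
move=> fK fC; pose a s x := f s * x.
have key : forall l, letters S l -> forall x,
    foldr a x (wd (prodl l)) = foldr a x l.
  apply: wd_act => [s x Ss|s t x Ss St c]; rewrite /a mulgA.
    by rewrite fK // mul1g.
  by rewrite fC // mulgA.
exists (fun g => foldr a 1 (wd g)) => [_ _ [l hl ->] [m hm ->]|s Ss].
  rewrite -prodl_cat !key //; last exact: letters_cat.
  rewrite foldr_cat; set b := foldr a 1 m.
  by elim: l {hl} => [|x l IH] /=; rewrite ?mul1g // IH /a mulgA.
have hs : letters S [:: s] by apply/letters_consP.
by have := key _ hs 1; rewrite /= /a !mulg1.
Qed.

(** The retraction onto the special subgroup on [Y], killing all other generators. *)
Definition ret Y g := prodl [seq x <- wd g | `[<Y x>]].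

Lemma ret_prodl Y l : letters S l -> ret Y (prodl l) = prodl [seq x <- l | `[<Y x>]].
Proof.
move=> hl; pose a s x := if `[<Y s>] then s * x else x : G.
have aE m : foldr a 1 m = prodl [seq x <- m | `[<Y x>]].
  by elim: m => [//|x m IH] /=; rewrite {1}/a IH; case: ifP.
rewrite /ret -!aE; apply: wd_act => // [s x Ss|s t x Ss St c]; rewrite /a.
  by case: `[<Y s>]; rewrite // mulgA sq // mul1g.
by case: `[<Y s>]; case: `[<Y t>]; rewrite // !mulgA c.
Qed.

Lemma retM Y g h : span S g -> span S h -> ret Y (g * h) = ret Y g * ret Y h.
Proof.
move=> [l hl ->] [m hm ->]; rewrite -prodl_cat !ret_prodl //.
  by rewrite filter_cat prodl_cat.
exact: letters_cat.
Qed.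

Lemma retV Y g : span S g -> ret Y g^-1 = (ret Y g)^-1.
Proof.
move=> hg; apply/esym/mulg1_eq; rewrite -retM ?mulgV //; last exact: spanV.
exact: (ret_prodl Y (@letters_nil _ S)).
Qed.

Lemma ret_span X Y g : X `<=` S -> span X g -> span (X `&` Y) (ret Y g).
Proof.
move=> sub [l hl ->]; rewrite ret_prodl; last exact: letters_sub hl.
by apply: span_prodl => x; rewrite mem_filter => /andP[/asboolP ? /hl].
Qed.

Lemma ret_id Y g : Y `<=` S -> span Y g -> ret Y g = g.
Proof.
move=> sub [l hl ->]; rewrite ret_prodl; last exact: letters_sub hl.
by congr prodl; apply/all_filterP/allP => x /hl /asboolP.
Qed.

Lemma span_cap X Y g : X `<=` S -> Y `<=` S -> span X g -> span Y g ->
  span (X `&` Y) g.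
Proof. by move=> sX sY hX hY; rewrite -(ret_id sY hY); apply: ret_span. Qed.

(** The parity of the number of letters [s], that is, the coordinate at [s] in the elementary
    abelian 2-quotient. *)
Definition chi s g : bool := foldr (fun x b => (x == s) (+) b) false (wd g).

Lemma chi_prodl s l : letters S l ->
  chi s (prodl l) = foldr (fun x b => (x == s) (+) b) false l.
Proof.
move=> hl; rewrite /chi; apply: wd_act => // [t x _|t u x _ _ _].
  exact: addKb.
exact: addbCA.
Qed.

Lemma chiM s g h : span S g -> span S h -> chi s (g * h) = chi s g (+) chi s h.
Proof.
move=> [l hl ->] [m hm ->]; rewrite -prodl_cat !chi_prodl //.
  rewrite foldr_cat; elim: l {hl} => [//|x l IH] /=; by rewrite IH addbA.
exact: letters_cat.
Qed.

Lemma chi1 s : chi s 1 = false.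
Proof. exact: (chi_prodl s (@letters_nil _ S)). Qed.

Lemma chi_gen s t : S t -> chi s t = (t == s).
Proof.
move=> St; have hs : letters S [:: t] by apply/letters_consP.
by have := chi_prodl s hs; rewrite /= mulg1 addbF.
Qed.

Lemma chiJ s g h : span S g -> span S h -> chi s (g * h * g^-1) = chi s h.
Proof.
move=> hg hh; have hV : span S g^-1 by apply: spanV.
have := chi1 s; rewrite -(mulgV g) !chiM //; last exact: spanM.
by case: (chi s g) (chi s h) (chi s g^-1) => [] [] [].
Qed.

Lemma chi_span X s g : X `<=` S -> span X g -> ~ X s -> chi s g = false.
Proof.
move=> sub [l hl ->] nX; rewrite chi_prodl; last exact: letters_sub hl.
elim: l hl => [//|x l IH] /letters_consP[Xx hl] /=; rewrite IH // addbF.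
by apply/eqP => e; rewrite e in Xx.
Qed.

Lemma span_mem X s : X `<=` S -> S s -> span X s -> X s.
Proof.
move=> sub Ss h; apply: contrapT => nX.
by have := chi_span sub h nX; rewrite chi_gen // eqxx.
Qed.

(* The reflection cocycle: [nn w r] says that the wall of the reflection [r]
   separates [1] from [w]. *)
Let refl_act (s : G) (p : G * bool) := (s * p.1 * s, p.2 (+) (p.1 == s)).

Definition nn g r : bool := (foldr refl_act (r, false) (rev (wd g))).2.

Lemma conj_sq s x : S s -> s * (s * x * s) * s = x.
Proof. by move=> Ss; rewrite !mulgA sq // mul1g -mulgA sq // mulg1. Qed.

Lemma conj_eq s x y : S s -> (s * x * s == y) = (x == s * y * s).
Proof.
by move=> Ss; apply/eqP/eqP => [<-|->]; rewrite conj_sq.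
Qed.

Lemma nn_prodl l r : letters S l ->
  nn (prodl l) r = (foldr refl_act (r, false) (rev l)).2.
Proof.
move=> hl; rewrite /nn; congr (_.2).
have [h1 h2] := wdP (span_prodl hl).
apply: (racg_act racgS); try exact: letters_rev.
- move=> s [x b] Ss; rewrite /refl_act /= conj_sq // conj_eq // sq // mul1g.
  by rewrite -addbA addbb addbF.
- move=> s t [x b] Ss St c; rewrite /refl_act /=; congr pair.
    by rewrite !mulgA c -!mulgA c.
  have e1 : t * s * t = s by rewrite -c -mulgA sq // mulg1.
  have e2 : s * t * s = t by rewrite c -mulgA sq // mulg1.
  by rewrite !conj_eq // -!addbA e1 e2; congr (_ (+) _); rewrite addbC.
- by rewrite !(prodl_rev sq) // h2.
Qed.

Lemma nn_act_snd l r b :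
  (foldr refl_act (r, b) l).2 = b (+) (foldr refl_act (r, false) l).2
  /\ (foldr refl_act (r, b) l).1 = (foldr refl_act (r, false) l).1.
Proof.
elim: l => [|x l [IH1 IH2]] /=; first by rewrite addbF.
by rewrite /refl_act IH1 IH2 addbA.
Qed.

Lemma nn1 r : nn 1 r = false.
Proof. exact: (nn_prodl r (@letters_nil _ S)). Qed.

Lemma nn_cons s w r : S s -> span S w -> nn (s * w) r = (r == s) (+) nn w (s * r * s).
Proof.
move=> Ss [l hl ->].
have hs : letters S (s :: l) by apply/letters_consP.
rewrite -[s * prodl l]/(prodl (s :: l)) !nn_prodl // rev_cons -cats1 foldr_cat.
by rewrite /= {2}/refl_act /= (proj1 (nn_act_snd _ _ _)).
Qed.

Lemma nn_gen s r : S s -> nn s r = (r == s).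
Proof. by move=> Ss; rewrite -{1}(mulg1 s) nn_cons ?nn1 ?addbF //; exact: span1. Qed.

Lemma nnM v w r : span S v -> span S w ->
  nn (v * w) r = nn v r (+) nn w (v^-1 * r * v).
Proof.
move=> [l hl ->] hw; elim: l r hl => [|x l IH] r /=.
  by rewrite nn1 !mul1g mulg1 invg1 mul1g.
move=> /letters_consP[Sx hl]; have hpl := span_prodl hl.
rewrite -mulgA nn_cons //; last exact: spanM.
by rewrite IH // nn_cons // addbA invgM (racg_inv Sx) !mulgA.
Qed.

(** The exchange condition: a wall between 1 and the product is crossed at some letter of the word,
    and multiplication by its reflection deletes that letter. *)
Lemma exchange l r : letters S l -> nn (prodl l) r ->
  exists m, [/\ letters S m, size m < size l & r * prodl l = prodl m].
Proof.
elim: l r => [|x l IH] r; first by rewrite nn1.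
move=> /letters_consP[Sx hl] /=; rewrite nn_cons //; last exact: span_prodl.
case: eqP => [->|_] /=.
  by exists l; split=> //; rewrite mulgA sq // mul1g.
move=> /IH [//|m [hm sm e]]; exists (x :: m); split=> //=.
  exact/letters_consP.
by rewrite -e !mulgA sq // mul1g.
Qed.

(** A generator [u] with [nn w u] is a left descent of [w]. If the first letter is not a descent of
    the whole product, it is one of the remaining word, and the exchange condition gives a shorter
    word. *)
Lemma nn_eq1 l : letters S l -> (forall u, S u -> ~~ nn (prodl l) u) ->
  prodl l = 1.
Proof.
elim: {l}(size l).+1 {-2}l (ltnSn (size l)) => [//|n IH] [//|u l] /= sl.
move=> /letters_consP[Su hl] h; have hpl := span_prodl hl.
have : nn (prodl l) u.
  by have := h u Su; rewrite nn_cons // eqxx /= negbK sq // mul1g.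
move=> /(exchange hl) [m [hm sm e]]; rewrite e.
by apply: IH => //; [lia|rewrite -e].
Qed.

(** * Infinite dihedral subgroups acting on the line *)

Section Dihedral.
Variables s u : G.
Hypotheses (Ss : S s) (Su : S u) (nsu : ~ commute s u).

Let sNu : (s == u) = false.
Proof. by apply/eqP => e; apply: nsu; rewrite e; exact: commute_refl. Qed.

(* Kills every generator except [s] and [u], which become the reflections of
   the line in the points 0 and 2. *)
Definition line_act (t : G) (x : int) : int :=
  if t == s then (- x)%R else if t == u then (4 - x)%R else x.

Lemma line_act_eq l m x : letters S l -> letters S m -> prodl l = prodl m ->
  foldr line_act x l = foldr line_act x m.
Proof.
move=> hl hm e; apply: (racg_act racgS) => // [t y _|t t' y _ _ c].
  by rewrite /line_act; case: (t == s); case: (t == u); lia.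
rewrite /line_act.
case: (eqVneq t s) c => [->|_]; case: (eqVneq t' s) => [->|_] // c.
  by case: (eqVneq t' u) c => [->|] // /nsu.
  by case: (eqVneq t u) c => [->|] // /commute_sym/nsu.
by case: (t == u); case: (t' == u).
Qed.

(** The mirrors 0 and 2 make the offset modulo 8 record the parity of [u]. *)
Lemma line_act_affine l :
  let a := foldr (fun y b => (y == s) (+) b) false l in
  let b := foldr (fun y b => (y == u) (+) b) false l in
  exists c : int, forall x, foldr line_act x l =
    ((if a (+) b then - x else x) + 8 * c + (if b then 4 else 0))%R.
Proof.
elim: l => [|y l [c IH]] /=; first by exists 0%R => x; lia.
move: IH; move: (foldr (fun y b => (y == s) (+) b) _ _) => a.
move: (foldr (fun y b => (y == u) (+) b) _ _) => b IH.
case: (eqVneq y s) => [->|/negPf ys]; rewrite ?sNu.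
  exists (- c - (if b then 1 else 0))%R => x; rewrite IH /line_act eqxx.
  by case: a {IH}; case: b => /=; lia.
case: (eqVneq y u) => [->|/negPf yu].
  exists (- c)%R => x; rewrite IH /line_act eq_sym sNu eqxx.
  by case: a {IH}; case: b => /=; lia.
by exists c => x; rewrite IH /line_act ys yu.
Qed.

(** With both parities odd, [r] would translate the line by [8 * c + 4], which is never 0, and
    [r * r] would act nontrivially. *)
Lemma involution_chi r : span S r -> r * r = 1 -> ~~ (chi s r && chi u r).
Proof.
move=> [l hl ->] e; apply/negP; rewrite !chi_prodl // => /andP[as_ au].
have hll : letters S (l ++ l) by apply: letters_cat.
have := line_act_eq 0%R hll (@letters_nil _ S); rewrite prodl_cat e => /(_ erefl).
have [c] := line_act_affine l.
rewrite as_ au foldr_cat /= => h; rewrite !h; lia.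
Qed.

End Dihedral.

Fixpoint alt n (s u : G) : seq G := if n is m.+1 then s :: alt m u s else [::].

Lemma alt_rcons n s u : rcons (alt n s u) (if odd n then u else s) = alt n.+1 s u.
Proof.
elim: n s u => [//|n IH] s u /=; congr cons.
by rewrite -[RHS](IH u s); case: (odd n).
Qed.

Lemma letters_alt n s u : S s -> S u -> letters S (alt n s u).
Proof.
by elim: n s u => [//|n IH] s u Ss Su /=; apply/letters_consP; split=> //; exact: IH.
Qed.

(** Ping-pong from the point 1, which lies between the mirrors at 0 and 2: the side on which a
    nonempty alternating word lands reveals its first letter. *)
Lemma alt_ping s u n : (s == u) = false ->
  (foldr (line_act s u) 1%R (alt n.+1 s u) < 0)%R /\
  (foldr (line_act s u) 1%R (alt n.+1 u s) > 2)%R.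
Proof.
move=> ne.
have e1 x : line_act s u s x = (- x)%R by rewrite /line_act eqxx.
have e2 x : line_act s u u x = (4 - x)%R by rewrite /line_act eq_sym ne eqxx.
elim: n => [|n [IH1 IH2]]; first by rewrite /= e1 e2.
have step x l : foldr (line_act s u) 1%R (x :: l) =
  line_act s u x (foldr (line_act s u) 1%R l) by [].
by split; [rewrite (step s (alt n.+1 u s)) e1|
           rewrite (step u (alt n.+1 s u)) e2]; lia.
Qed.

Lemma alt_neq s u n : S s -> S u -> ~ commute s u -> (prodl (alt n.+1 u s) == s) = false.
Proof.
move=> Ss Su nsu; apply/eqP => e.
have ne : (s == u) = false by apply/eqP => h; apply: nsu; rewrite h.
have hs : letters S [:: s] by apply/letters_consP.
have ee : prodl (alt n.+1 u s) = prodl [:: s] by rewrite e /= mulg1.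
have := line_act_eq nsu 1%R (letters_alt Su Ss) hs ee.
have [_] := alt_ping n ne; set x := foldr _ _ _ => h1 h2; move: h1.
by rewrite h2 /= /line_act eqxx.
Qed.

(** An alternating word crosses no wall of an odd alternating word with the other first letter.
    Stripping a letter conjugates that reflection into one longer by two and swaps [s] with [u],
    hence the general [k]. *)
Lemma nn_alt n k s u : S s -> S u -> ~ commute s u ->
  nn (prodl (alt n s u)) (prodl (alt k.*2.+1 u s)) = false.
Proof.
elim: n k s u => [|n IH] k s u Ss Su nsu; first exact: nn1.
have h := span_prodl (letters_alt (n := n) Su Ss).
rewrite -[alt n.+1 s u]/(s :: alt n u s) [prodl (_ :: _)]/= nn_cons // alt_neq //=.
have -> : s * prodl (alt k.*2.+1 u s) * s = prodl (alt k.+1.*2.+1 s u).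
  rewrite doubleS -(alt_rcons k.*2.+2 s u) -cats1 prodl_cat /= odd_double /= mulg1.
  by rewrite !mulgA.
by apply: IH => // /commute_sym.
Qed.

Lemma dihedral_alt s u p : S s -> S u -> letters [set s; u] p ->
  exists n, prodl p = prodl (alt n s u) \/ prodl p = prodl (alt n u s).
Proof.
move=> Ss Su; elim: p => [_|x p IH /letters_consP[hx /IH [n hn]]].
  by exists 0; left.
have step a b : S a -> S b -> x = a ->
    prodl p = prodl (alt n a b) \/ prodl p = prodl (alt n b a) ->
    exists n, prodl (x :: p) = prodl (alt n a b) \/ prodl (x :: p) = prodl (alt n b a).
  move=> Sa Sb -> [] /= ->; last by exists n.+1; left.
  case: n {hn} => [|n]; first by exists 1%N; left.
  by exists n; right; rewrite /= mulgA sq // mul1g.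
case: hx => e; first exact: step.
have [||||k [h|h]] := step u s => //; try by exists k; auto.
by case: hn; auto.
Qed.

(** As long as some wall in the dihedral subgroup is crossed, the exchange condition moves its
    reflection into the left factor and shortens the rest. *)
Lemma coset_decomp s u l : S s -> S u -> letters S l -> exists p q,
  [/\ letters [set s; u] p, letters S q, prodl l = prodl p * prodl q &
     forall r, span [set s; u] r -> ~~ nn (prodl q) r].
Proof.
move=> Ss Su; have sub : [set s; u] `<=` S by move=> x [] ->.
elim: {l}(size l).+1 {-2}l (ltnSn (size l)) => [//|n IH] l sl hl.
have [[r hr nr]|no] := pselect (exists2 r, span [set s; u] r & nn (prodl l) r).
  have [m [hm sm e]] := exchange hl nr.
  have [|p [q [hp hq epq hh]]] := IH m _ hm; first exact: leq_trans sm sl.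
  have [p' hp' ep'] := spanV sub hr.
  exists (p' ++ p), q; split=> //; first exact: letters_cat.
  by rewrite prodl_cat -mulgA -epq -e -ep' mulKg.
exists [::], l; split=> //; first by rewrite mul1g.
by move=> r hr; apply/negP => nr; apply: no; exists r.
Qed.

(** Only the dihedral factor decides [nn] at [s] and [u]; it is an alternating word, and of the two
    letters only its first can be a descent. *)
Lemma nn_noncommuting s u w : S s -> S u -> ~ commute s u -> span S w ->
  nn w s -> nn w u -> False.
Proof.
move=> Ss Su nsu [l hl ->].
have [p [q [hp hq -> hh]]] := coset_decomp Ss Su hl.
have sub : [set s; u] `<=` S by move=> x [] ->.
have sp := span_sub sub (span_prodl hp).
have E x : span [set s; u] x -> nn (prodl p * prodl q) x = nn (prodl p) x.
  move=> hx; rewrite nnM //; last exact: span_prodl.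
  have hV : span [set s; u] (prodl p)^-1 by apply: spanV => //; apply: span_prodl.
  rewrite (negPf (hh _ _)) ?addbF //.
  by apply: spanM; [apply: spanM|apply: span_prodl].
rewrite (E s) ?(E u); try by apply: span_gen; first [by left|by right].
have [n [->|->]] := dihedral_alt Ss Su hp.
  by move=> _; have := nn_alt n 0 Ss Su nsu; rewrite /= mulg1 => ->.
have nus : ~ commute u s by move=> /commute_sym.
by have := nn_alt n 0 Su Ss nus; rewrite /= mulg1 => ->.
Qed.

(** * Centralizers and involutions *)

Definition star s : set G := [set x | S x /\ commute x s].

Lemma star_sub s : star s `<=` S.
Proof. by move=> x []. Qed.

(** Descents of [w] that commute with [s] are split off. Any other descent [u] would make [s] and
    [u] two noncommuting descents of [s * w = w * s]. *)
Lemma centralizer_gen s w : S s -> span S w -> commute w s -> span (star s) w.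
Proof.
move=> Ss [l hl ->]; move: hl.
elim: {l}(size l).+1 {-2}l (ltnSn (size l)) => [//|n IH] l sl hl c.
have hw := span_prodl hl.
have step v : star s v -> nn (prodl l) v -> span (star s) (prodl l).
  move=> [Sv cv] /(exchange hl) [m [hm sm e]].
  have -> : prodl l = v * prodl m by rewrite -e mulgA sq // mul1g.
  apply: spanM; first by apply: span_gen.
  apply: IH => //; first exact: leq_trans sm sl.
  by rewrite -e; apply/commute_sym/commuteM; apply/commute_sym.
have [/step|ns] := boolP (nn (prodl l) s).
  by apply; split=> //; exact: commute_refl.
have [[u Su nu]|no] := pselect (exists2 u, S u & nn (prodl l) u); last first.
  rewrite nn_eq1 //; first exact: span1.
  by move=> u Su; apply/negP => nu; apply: no; exists u.
have [cu|nc] := pselect (commute u s); first exact: step nu.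
have hs : span S s by apply: span_gen.
have e1 : nn (s * prodl l) u.
  rewrite -c nnM // nu nn_gen //; apply/eqP => e; apply: nc.
  have : u = prodl l * s * (prodl l)^-1.
    by rewrite -e !mulgA mulgV mul1g mulgK.
  by rewrite c mulgK => ->; exact: commute_refl.
have e2 : nn (s * prodl l) s.
  by rewrite nn_cons // eqxx sq // mul1g (negPf ns).
exfalso; apply: (nn_noncommuting Ss Su _ _ e2 e1).
  by move=> /commute_sym.
exact: spanM.
Qed.

Definition clique K :=
  [/\ letters S K, uniq K & {in K &, forall x y, commute x y}].

Lemma clique_cons x K : clique (x :: K) ->
  [/\ S x, clique K, x \notin K & forall y, y \in K -> commute x y].
Proof.
move=> [/letters_consP[Sx hK] /= /andP[nx uK] cK]; split=> //.
  by split=> // y z yK zK; apply: cK; rewrite in_cons ?yK ?zK orbT.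
by move=> y yK; apply: cK; rewrite in_cons ?eqxx // yK orbT.
Qed.

Lemma nn_clique K r : clique K -> nn (prodl K) r = (r \in K).
Proof.
elim: K r => [|x K IH] r; first by rewrite nn1.
move=> /clique_cons[Sx cK nx cx]; have [hK _ _] := cK.
rewrite [prodl _]/= nn_cons //; last exact: span_prodl.
rewrite IH // in_cons.
have -> : (x * r * x \in K) = (r \in K).
  have aux y : y \in K -> x * y * x = y.
    by move=> /cx cxy; rewrite cxy -mulgA sq // mulg1.
  apply/idP/idP => [h|h]; last by rewrite aux.
  by rewrite -[r](@conj_sq x) // aux.
by case: eqP => [->|//]; rewrite (negPf nx).
Qed.

(* A descent of [w] in the clique can be cancelled, and without one [w]
   permutes the clique, hence fixes it since conjugate generators are equal. *)
Lemma centralizer_clique K k w : clique K -> k \in K -> span S w ->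
  commute w (prodl K) -> commute w k.
Proof.
move=> cK; have [hK _ ccK] := cK; move=> kK [l hl ->]; move: hl.
elim: {l}(size l).+1 {-2}l (ltnSn (size l)) => [//|n IH] l sl hl c.
have hw := span_prodl hl; have hc := span_prodl hK.
have [[k' k'K nk']|no] := pselect (exists2 k', k' \in K & nn (prodl l) k').
  have [m [hm sm e]] := exchange hl nk'.
  have Sk' := hK _ k'K.
  have -> : prodl l = k' * prodl m by rewrite -e mulgA sq // mul1g.
  apply/commute_sym/commuteM; first exact: ccK.
  apply/commute_sym/IH => //; first exact: leq_trans sm sl.
  rewrite -e; apply/commute_sym/commuteM; apply/commute_sym => //.
  by apply: prodl_commute => x xK; apply: ccK.
have ck : (prodl K)^-1 * k * prodl K = k.
  have : commute k (prodl K) by apply: prodl_commute => x xK; apply: ccK.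
  by rewrite -mulgA => ->; rewrite mulKg.
have : nn (prodl K * prodl l) k.
  rewrite nnM // nn_clique // kK ck.
  by apply/negP => nk; apply: no; exists k.
rewrite -c nnM // (nn_clique _ cK).
have -> : nn (prodl l) k = false.
  by apply/negP => nk; apply: no; exists k.
rewrite addFb; set k' := _ * _ * _ => k'K.
have ek : k = prodl l * k' * (prodl l)^-1.
  by rewrite /k' !mulgA mulgV mul1g mulgK.
have : chi k k by rewrite chi_gen ?eqxx //; apply: hK.
rewrite {2}ek chiJ //; last by apply/span_gen/hK.
rewrite chi_gen; last exact: hK.
move=> /eqP e; move: ek; rewrite e => h.
by rewrite /commute {2}h mulgVK.
Qed.

(** Induction on length at a descent [s]. If [s] does not commute with [r], then [s * r * s] is an
    involution with a shorter word; if it does, so is [s * r]. *)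
Lemma involution_conj r : span S r -> r * r = 1 ->
  exists g K, [/\ span S g, clique K & r = g * prodl K * g^-1].
Proof.
move=> [l hl ->]; move: hl.
elim: {l}(size l).+1 {-2}l (ltnSn (size l)) => [//|n IH] l sl hl e.
have hw := span_prodl hl.
have [[s Ss ns]|no] := pselect (exists2 u, S u & nn (prodl l) u); last first.
  exists 1, [::]; split; [exact: span1|by []|].
  rewrite nn_eq1 ?mul1g ?invg1 //.
  by move=> u Su; apply/negP => nu; apply: no; exists u.
have hs := span_gen Ss.
have [m [hm sm em]] := exchange hl ns.
have sm' : size m < n by exact: leq_trans sm sl.
have el : prodl l = s * prodl m by rewrite -em mulgA sq // mul1g.
have lV : (prodl l)^-1 = prodl l by exact: mulg1_eq e.
have [c|nc] := pselect (commute s (prodl l)); last first.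
  have em' : prodl l * s = prodl (rev m).
    by rewrite (prodl_rev sq) // -em invgM (racg_inv Ss) lV.
  have : nn (prodl (rev m)) s.
    rewrite -em' nnM // ns nn_gen // addTb; apply/eqP => h; apply: nc.
    by rewrite /commute -{2}h -mulgA mulVKg.
  move=> /(exchange (letters_rev hm)) [m' [hm' sm2 em2]].
  have [||g [K [hg cK eK]]] := IH m' _ hm'.
  - by rewrite (leq_trans sm2) // size_rev ltnW.
  - by rewrite -em2 -em' !mulgA -(mulgA _ s s) sq // mulg1 -(mulgA _ _ (prodl l)) e mulg1 sq.
  exists (s * g), K; split=> //; first exact: spanM.
  rewrite invgM (racg_inv Ss) !mulgA -(mulgA s) -(mulgA s) -eK -em2 -em'.
  by rewrite !mulgA sq // mul1g -mulgA sq // mulg1.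
have [|g [K [hg cK eK]]] := IH m sm' hm.
  by rewrite -em {1}c -mulgA (mulgA s s) sq // mul1g.
have cm : commute (prodl m) s.
  by rewrite -em; apply/commute_sym/commuteM; first exact: commute_refl.
have sv := centralizer_gen Ss (span_prodl hm) cm.
have [hK uK ccK] := cK; have hpK := span_prodl hK.
have hgV : span S g^-1 by apply: spanV.
(* Retracting onto the star of [s] puts the conjugator and the clique there. Then [s] commutes with
   both, and can be removed from the clique or added to it. *)
have := ret_id (@star_sub s) sv.
rewrite {1}eK !retM ?retV ?ret_prodl //; last exact: spanM.
set g' := ret _ g; set K' := filter _ K => em2.
have hg' : span (star s) g'.
  by have := ret_span (star s) (@subset_refl _ S) hg; apply: span_sub => x [].
have subK : {subset K' <= K} by move=> x; rewrite mem_filter => /andP[].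
have stK x : x \in K' -> star s x by rewrite mem_filter => /andP[/asboolP].
have csg : commute s g' by apply: span_commute hg' _ => x [_ /commute_sym].
have cK' : clique K'.
  split; [by move=> x /subK/hK|exact: filter_uniq|].
  by move=> x y /subK xK /subK yK; apply: ccK.
have eg K2 : s * prodl K' = prodl K2 -> prodl l = g' * prodl K2 * g'^-1.
  by move=> <-; rewrite el -em2 !mulgA csg.
have sg' : span S g' by apply: span_sub hg'; exact: star_sub.
have [hK' uK' ccK'] := cK'.
have [sK|nsK] := boolP (s \in K').
  exists g', (rem s K'); split=> //.
    split; [by move=> x /mem_rem/hK'|exact: rem_uniq|].
    by move=> x y /mem_rem xK /mem_rem yK; apply: ccK'.
  by apply: eg; rewrite (prodl_rem ccK' sK) mulgA sq // mul1g.
exists g', (s :: K'); split=> //; last exact: eg.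
split; [exact/letters_consP|by rewrite /= nsK|].
move=> x y; rewrite !in_cons.
move=> /orP[/eqP->|xK] /orP[/eqP->|yK]; first exact: commute_refl.
- by have [_ /commute_sym] := stK _ yK.
- by have [_] := stK _ xK.
- exact: ccK'.
Qed.

End Theory.

(** * Rigidity *)

Section Parity.
Variables (G : groupType) (S : set G).
Hypothesis racgS : racg S.

Definition parity_hom (H : set G) (f : G -> bool) :=
  forall x y, H x -> H y -> f (x * y) = f x (+) f y.

(* Equality in the largest elementary abelian 2-quotient of [H]. *)
Definition eqv (H : set G) (g h : G) :=
  forall f, parity_hom H f -> f g = f h.

Lemma eqv_chi s g h : eqv (span S) g h -> chi S s g = chi S s h.
Proof. by apply=> x y hx hy; exact: chiM. Qed.

Lemma parity1 f : parity_hom (span S) f -> f 1 = false.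
Proof.
move=> hf; have := hf 1 1 (span1 S) (span1 S); rewrite mulg1.
by case: (f 1).
Qed.

Lemma parity_rem f l x : parity_hom (span S) f -> letters S l -> x \in l ->
  f (prodl l) = f x (+) f (prodl (rem x l)).
Proof.
move=> hf; elim: l => [//|y l IH] /letters_consP[Sy hl]; rewrite in_cons eq_sym /=.
have hpl := span_prodl hl; have hy := span_gen Sy.
case: (eqVneq y x) => [<- _|_ /= xl]; first exact: hf.
rewrite !hf //; first by rewrite IH // addbCA.
by apply: span_prodl => z /mem_rem/hl.
Qed.

Lemma parity_list g : span S g ->
  exists L, [/\ letters S L, uniq L & eqv (span S) g (prodl L)].
Proof.
move=> [l hl ->]; elim: l hl => [_|x l IH]; first by exists [::].
move=> /letters_consP[Sx hl]; have [L [hL uL eL]] := IH hl.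
have hx := span_gen Sx; have hpl := span_prodl hl.
have [xL|xL] := boolP (x \in L).
  exists (rem x L); split; [by move=> z /mem_rem/hL|exact: rem_uniq|].
  move=> f hf; rewrite /= hf // (eL f hf) (parity_rem hf hL xL).
  by rewrite addbA addbb.
exists (x :: L); split; [exact/letters_consP|by rewrite /= xL|].
by move=> f hf; rewrite /= !hf ?(eL f hf) //; exact: span_prodl.
Qed.

Lemma chi_uniq s L : letters S L -> uniq L -> chi S s (prodl L) = (s \in L).
Proof.
move=> hL uL; rewrite chi_prodl //.
elim: L uL {hL} => [//|x L IH] /= /andP[xL /IH ->]; rewrite in_cons eq_sym.
by case: eqP => // ->; rewrite (negPf xL).
Qed.

Lemma prodl_sq L : letters S L -> {in L &, forall x y, commute x y} ->
  prodl L * prodl L = 1.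
Proof.
elim: L => [|x L IH]; first by rewrite /= mulg1.
move=> /letters_consP[Sx hL] cL; rewrite [prodl _]/= -mulgA (mulgA _ x).
have -> : prodl L * x = x * prodl L.
  apply/esym/prodl_commute => y yL; apply: cL; first exact: mem_head.
  by rewrite in_cons yL orbT.
rewrite -(mulgA x) IH ?mulg1 ?(racg_sq racgS) // => y z yL zL.
by apply: cL; rewrite in_cons ?yL ?zL orbT.
Qed.

Lemma parity_prodl f l : parity_hom (span S) f -> letters S l -> f (prodl l) ->
  exists2 k, k \in l & f k.
Proof.
move=> hf; elim: l => [|x l IH]; first by rewrite /= parity1.
move=> /letters_consP[Sx hl] /=; rewrite hf; [|exact: span_gen|exact: span_prodl].
have [fx _|_ /= /(IH hl)[k kl fk]] := boolP (f x); first by exists x; rewrite ?mem_head.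
by exists k => //; rewrite in_cons kl orbT.
Qed.

(** This depends on [S] only through [span S], so two bases of one group share it. By the next two
    lemmas it says, in either basis, that the generators of odd parity in [g] commute pairwise; so
    commutation can be compared across bases. *)
Definition inv_class (g : G) :=
  exists r, [/\ span S r, r * r = 1 & eqv (span S) g r].

Lemma inv_class_chi s t g : S s -> S t -> inv_class g ->
  chi S s g -> chi S t g -> commute s t.
Proof.
move=> Ss St [r [hr er e]]; rewrite !(eqv_chi _ e) => h1 h2.
apply: contrapT => n; have := involution_chi racgS n hr er.
by rewrite h1 h2.
Qed.

Lemma chi_inv_class g : span S g ->
  (forall s t, S s -> S t -> chi S s g -> chi S t g -> commute s t) ->
  inv_class g.
Proof.
move=> /parity_list[L [hL uL e]] h; exists (prodl L); split=> //.
  exact: span_prodl.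
apply: prodl_sq => // x y xL yL; apply: h; try exact: hL.
  by rewrite (eqv_chi _ e) chi_uniq.
by rewrite (eqv_chi _ e) chi_uniq.
Qed.

End Parity.

(** * Comparison of two bases of the same group *)

Section Rigidity.
Variables (G : groupType) (S S2 : set G).
Hypotheses (racgS : racg S) (racgS2 : racg S2) (spanE : span S = span S2).
Variables (p : G) (D : set G).
Hypotheses (Sp : S p) (nDp : ~ D p).
(** When there is no witness [x], the transvection taking [s] to [s * y] changes the class of [s].
    Such pairs are confined to [s] in [D] and the single value [y = p]. *)
Hypothesis dominated : forall s y, S s -> S y -> s <> y -> commute s y ->
  (D s /\ y = p) \/
  exists x, [/\ S x, commute x s, x <> y & ~ commute x y].
Hypothesis dominating : forall s x, S s -> S x -> D s -> commute x s -> commute x p.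

Let inv_classE g : inv_class S g = inv_class S2 g.
Proof. by rewrite /inv_class spanE. Qed.

Let inv_involution g : span S g -> g * g = 1 -> inv_class S g.
Proof. by move=> h e; exists g; split. Qed.

Let S2span k : S2 k -> span S k.
Proof. by rewrite spanE; exact: span_gen. Qed.

Let inv_comm x y : S x -> S y -> commute x y -> inv_class S (x * y).
Proof.
move=> Sx Sy c; apply: inv_involution.
  by apply: spanM; exact: span_gen.
by rewrite {2}c -mulgA (mulgA y) !(racg_sq racgS) // mul1g (racg_sq racgS).
Qed.

Let inv_comm2 x y : S2 x -> S2 y -> commute x y -> inv_class S (x * y).
Proof.
move=> Sx Sy c; apply: inv_involution.
  by apply: spanM; exact: S2span.
by rewrite {2}c -mulgA (mulgA y) !(racg_sq racgS2) // mul1g (racg_sq racgS2).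
Qed.

(** Call letters of [g] the generators of odd parity in it. In [S2], the letters of each of [x], [s]
    and [x * s] commute pairwise, and any letter of [x] shares one of these sets with [k]. So [k]
    inherits, modulo squares, the commutations of [s]. *)
Lemma supp_inv_class s k x : S s -> S2 k -> chi S2 k s -> S x -> commute x s ->
  inv_class S (x * k).
Proof.
move=> Ss Sk ks Sx c.
have [hs hx hk] : [/\ span S2 s, span S2 x & span S2 k].
  by rewrite -spanE; split; [exact: span_gen|exact: span_gen|exact: S2span].
have ix : inv_class S2 x.
  rewrite -inv_classE; apply: inv_involution; first exact: span_gen.
  exact: (racg_sq racgS).
have is_ : inv_class S2 s.
  rewrite -inv_classE; apply: inv_involution; first exact: span_gen.
  exact: (racg_sq racgS).
have ixs : inv_class S2 (x * s) by rewrite -inv_classE; exact: inv_comm.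
have key a : S2 a -> chi S2 a x -> commute a k.
  move=> Sa ax.
  have [as_|as_] := boolP (chi S2 a s); first exact: (inv_class_chi racgS2 _ _ is_).
  have [kx|kx] := boolP (chi S2 k x); first exact: (inv_class_chi racgS2 _ _ ix).
  apply: (inv_class_chi racgS2 _ _ ixs) => //; rewrite chiM //.
    by rewrite ax (negPf as_).
  by rewrite ks (negPf kx).
rewrite inv_classE; apply: chi_inv_class => // [|a b Sa Sb]; first exact: spanM.
rewrite !chiM // !(chi_gen racgS2 _ Sk).
case: (eqVneq k a) => [ka|_]; case: (eqVneq k b) => [kb|_]; rewrite ?addbT ?addbF.
- by move=> _ _; rewrite -ka -kb.
- by move=> _ bx; rewrite -ka; apply/commute_sym/key.
- by move=> ax _; rewrite -kb; exact: key.
- exact: (inv_class_chi racgS2 _ _ ix).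
Qed.

(** As [k] inherits the commutations of [s], each of its letters [y] commutes with whatever commutes
    with [s], and [dominated] applies. *)
Lemma supp_dominator s k y : S s -> S2 k -> chi S2 k s -> S y -> chi S y k ->
  y = s \/ D s /\ y = p.
Proof.
move=> Ss Sk ks Sy yk.
have [->|/eqP ys] := eqVneq y s; first by left.
have hk := S2span Sk; have hs := span_gen Ss; have hy := span_gen Sy.
have ik : inv_class S k.
  by apply: inv_involution => //; exact: (racg_sq racgS2).
have csy : commute s y.
  have [sk|sk] := boolP (chi S s k); first exact: (inv_class_chi racgS _ _ ik).
  have isk : inv_class S (s * k).
    by apply: (supp_inv_class Ss); rewrite //; exact: commute_refl.
  apply: (inv_class_chi racgS _ _ isk) => //; rewrite chiM // chi_gen //.
    by rewrite eqxx (negPf sk).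
  by rewrite yk eq_sym; move/eqP/negPf: ys => ->.
case: (dominated Ss Sy _ csy) => [e|//|]; first by apply: ys.
  by right.
move=> [x [Sx cx /eqP/negPf xy nc]]; case: nc.
have [xk|xk] := boolP (chi S x k); first exact: (inv_class_chi racgS _ _ ik).
have ixk : inv_class S (x * k) by exact: (supp_inv_class Ss).
have hx := span_gen Sx.
apply: (inv_class_chi racgS _ _ ixk) => //; rewrite chiM // chi_gen //.
  by rewrite eqxx (negPf xk).
by rewrite yk xy.
Qed.

(** The coordinate of [s] at itself is a sum over its letters in [S2], so one of these, [k], has [s]
    as a letter in turn. Its only other possible letter is [p]. *)
Lemma rigid_gen s : S s -> exists k, S2 k /\
  (eqv (span S) k s \/ D s /\ eqv (span S) k (s * p)).
Proof.
move=> Ss; have hs : span S2 s by rewrite -spanE; exact: span_gen.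
have [L2 [hL2 uL2 e2]] := parity_list hs.
have : chi S s (prodl L2).
  by rewrite -spanE in e2; rewrite -(eqv_chi racgS _ e2) chi_gen ?eqxx.
have hf : parity_hom (span S2) (chi S s) by rewrite -spanE => x y; exact: chiM.
move=> /(parity_prodl hf hL2) [k kL sk]; exists k.
have Sk := hL2 _ kL; split=> //.
have ks : chi S2 k s by rewrite (eqv_chi racgS2 _ e2) chi_uniq.
have [L [hL uL eL]] := parity_list (S2span Sk).
have Lsp y : y \in L -> y = s \/ D s /\ y = p.
  move=> yL; apply: (supp_dominator Ss Sk ks); first exact: hL.
  by rewrite (eqv_chi racgS _ eL) chi_uniq.
have sL : s \in L by rewrite -(chi_uniq racgS s hL uL) -(eqv_chi racgS _ eL).
have hL' : letters S (rem s L) by move=> z /mem_rem/hL.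
have [pL|pL] := boolP (p \in rem s L); last first.
  left=> f hf'; rewrite (eL f hf') (parity_rem hf' hL sL).
  have -> : rem s L = [::].
    case E : (rem s L) pL => [//|y m]; have : y \in rem s L by rewrite E mem_head.
    rewrite mem_rem_uniq // !inE => /andP[/eqP ys /Lsp[//|[_ ->]]].
    by rewrite eqxx.
  by rewrite (parity1 hf') addbF.
have pNs : p != s by move: pL; rewrite mem_rem_uniq // !inE => /andP[].
right; split.
  by case: (Lsp p (mem_rem pL)) => [e|[]//]; rewrite e eqxx in pNs.
move=> f hf'; rewrite (eL f hf') (parity_rem hf' hL sL) (parity_rem hf' hL' pL).
have -> : rem p (rem s L) = [::].
  case E : (rem p (rem s L)) => [//|y m].
  have : y \in rem p (rem s L) by rewrite E mem_head.
  rewrite mem_rem_uniq ?rem_uniq // !inE => /andP[/eqP yp].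
  by rewrite mem_rem_uniq // !inE => /andP[/eqP ys /Lsp[//|[]]].
by rewrite (parity1 hf') addbF hf' //; exact: span_gen.
Qed.

Lemma rigidity : exists phi : G -> G,
  [/\ forall s, S s -> S2 (phi s),
      forall s t, S s -> S t -> phi s = phi t -> s = t,
      forall k, S2 k -> exists2 s, S s & phi s = k &
      forall s t, S s -> S t -> (commute s t <-> commute (phi s) (phi t))].
Proof.
have /choice[phi hphi] : forall s, exists k, S s -> S2 k /\
    (eqv (span S) k s \/ D s /\ eqv (span S) k (s * p)).
  move=> s; have [/rigid_gen[k hk]|n] := pselect (S s); first by exists k.
  by exists 1.
have S2phi s : S s -> S2 (phi s) by move=> /hphi[].
have hp := span_gen Sp.
have Dcomm s : S s -> D s -> commute p s.
  by move=> Ss Ds; apply/commute_sym/(dominating Ss Ss Ds)/commute_refl.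
(* Away from the coordinate [p], [phi s] and [s] have the same parities; at [p] this is known only
   for [s] outside [D]. *)
have Q1 s t : S s -> t <> p -> chi S t (phi s) = (s == t).
  move=> Ss tp; have hs := span_gen Ss.
  have pt : (p == t) = false by apply/eqP => e; apply: tp.
  have [_ [e|[_ e]]] := hphi s Ss; rewrite (eqv_chi racgS _ e) ?chiM // ?chi_gen //.
  by rewrite pt addbF.
have Q2 s : S s -> ~ D s -> chi S p (phi s) = (s == p).
  move=> Ss nD; have [_ [e|[Ds _]]] := hphi s Ss; last by case: nD.
  by rewrite (eqv_chi racgS _ e) chi_gen.
have inj s t : S s -> S t -> phi s = phi t -> s = t.
  move=> Ss St e; have [sp|/eqP sp] := eqVneq s p; have [tp|/eqP tp] := eqVneq t p.
  - by rewrite sp.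
  - by apply/eqP; rewrite -(Q1 s t) // e Q1.
  - by apply/esym/eqP; rewrite -(Q1 t s) // -e Q1.
  - by apply/eqP; rewrite -(Q1 s t) // e Q1.
have hphis s : S s -> span S (phi s) by move=> /S2phi/S2span.
exists phi; split=> //.
(* The parity of a missed [k] vanishes on all [phi s], hence on [p], which is not in [D], hence on
   every [s], hence on [k] itself. *)
- move=> k Sk; apply: contrapT => no.
  have hf : parity_hom (span S) (chi S2 k) by rewrite spanE => x y; exact: chiM.
  have z s : S s -> chi S2 k (phi s) = false.
    move=> Ss; rewrite chi_gen //; last exact: S2phi.
    by apply/eqP => e; apply: no; exists s.
  have zp : chi S2 k p = false.
    have [_ [e|[/nDp//]]] := hphi p Sp; by rewrite -(e _ hf) z.
  have zs s : S s -> chi S2 k s = false.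
    move=> Ss; have [_ [e|[_ e]]] := hphi s Ss; first by rewrite -(e _ hf) z.
    have := e _ hf; rewrite z // hf //; last exact: span_gen.
    by rewrite zp addbF.
  have [l hl el] := S2span Sk.
  have : chi S2 k (prodl l) by rewrite -el chi_gen ?eqxx.
  by move=> /(parity_prodl hf hl)[s /hl/zs ->].
(* Commutation is read off from the class of [phi s * phi t]. Its letters in [S] are among [s], [t]
   and an extra [p], which appears only if [s] or [t] is in [D]; [dominating] then makes [p] commute
   with both. *)
move=> s t Ss St; split=> c.
  have [->|/eqP st] := eqVneq s t; first exact: commute_refl.
  have ic : inv_class S (phi s * phi t).
    apply: chi_inv_class => //; first by apply: spanM; exact: hphis.
    have key a : S a -> chi S a (phi s * phi t) ->
        [\/ a = s, a = t | a = p /\ (D s \/ D t)].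
      move=> Sa; rewrite chiM //; try exact: hphis.
      have [ap|/eqP ap] := eqVneq a p; last first.
        rewrite !Q1 //; case: eqP => [->|_ /=]; first by constructor 1.
        by move=> /eqP ->; constructor 2.
      have [Ds|Ds] := pselect (D s); first by constructor 3; split; [|left].
      have [Dt|Dt] := pselect (D t); first by constructor 3; split; [|right].
      rewrite ap !Q2 //; case: eqP => [->|_ /=]; first by constructor 1.
      by move=> /eqP ->; constructor 2.
    have cp : D s \/ D t -> commute p s /\ commute p t.
      move=> [Ds|Dt]; split; try exact: Dcomm.
        by apply/commute_sym/(dominating Ss St Ds)/commute_sym.
      by apply/commute_sym/(dominating St Ss Dt).
    move=> a b Sa Sb /(key _ Sa) ha /(key _ Sb) hb.
    case: ha => [->|->|[-> /cp[h1 h2]]]; case: hb => [->|->|[-> /cp[h3 h4]]] //;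
      by [exact: commute_refl|exact: commute_sym].
  have hs2 : span S2 (phi s) by rewrite -spanE; exact: hphis.
  have ht2 : span S2 (phi t) by rewrite -spanE; exact: hphis.
  rewrite inv_classE in ic.
  have ne : (phi s == phi t) = false by apply/eqP => /inj; auto.
  apply: (inv_class_chi racgS2 _ _ ic); try exact: S2phi;
    rewrite chiM // !chi_gen ?eqxx //; try exact: S2phi.
    by rewrite eq_sym ne.
  by rewrite ne.
have [->|/eqP st] := eqVneq s t; first exact: commute_refl.
have ic : inv_class S (phi s * phi t) by apply: inv_comm2 => //; exact: S2phi.
have nst : (s == t) = false by apply/eqP.
have nts : (t == s) = false by rewrite eq_sym.
have [hs ht] : span S (phi s) /\ span S (phi t) by split; exact: hphis.
have [sp|/eqP sp] := eqVneq s p; have [tp|/eqP tp] := eqVneq t p.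
- by case: st; rewrite sp.
- have [Dt|Dt] := pselect (D t); first by rewrite sp; exact: Dcomm.
  apply: (inv_class_chi racgS _ _ ic) => //; rewrite chiM //.
    by rewrite sp !Q2 // eqxx -sp nts.
  by rewrite !Q1 // eqxx nst.
- have [Ds|Ds] := pselect (D s); first by rewrite tp; exact/commute_sym/Dcomm.
  apply: (inv_class_chi racgS _ _ ic) => //; rewrite chiM //.
    by rewrite !Q1 // eqxx nts.
  by rewrite tp !Q2 // eqxx -tp nst.
- apply: (inv_class_chi racgS _ _ ic) => //; rewrite chiM // !Q1 //.
    by rewrite eqxx nts.
  by rewrite eqxx nst.
Qed.

End Rigidity.

(** * The graphs *)

(* [gvertex I] is the vertex set of Gamma_B when B has a copy of Z for each
   [i : I], with origin [GZ i 0]. *)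
Inductive gvertex (I : Type) := GC of Cvertex | GN of nat | GZ of I & int.
Arguments GC {I}.
Arguments GN {I}.

Definition adjC (c d : Cvertex) : bool :=
  match c, d with
  | t0, t2 | t2, t0 | t2, t3 | t3, t2 | t3, t1 | t1, t3 | t1, t0 | t0, t1
  | t0, vs | vs, t0 | vs, t2 | t2, vs | t1, vs' | vs', t1 | vs', t3 | t3, vs'
  | vs, vs' | vs', vs => true
  | _, _ => false
  end.

Definition adjCN (c : Cvertex) (n : nat) : bool :=
  match c with
  | t0 | t2 => ~~ odd n
  | t1 => odd n || (n == 2)
  | t3 => odd n
  | _ => false
  end.

Definition adjCZ (c : Cvertex) (z : int) : bool :=
  if c is t3 then absz z <= 1 else false.

Definition adj (I : Type) (x y : gvertex I) : Prop :=
  match x, y with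
  | GC c, GC d => adjC c d
  | GC c, GN n | GN n, GC c => adjCN c n
  | GC c, GZ _ z | GZ _ z, GC c => adjCZ c z
  | GN n, GN m => (n == m.+1) || (m == n.+1)
  | GN n, GZ _ z | GZ _ z, GN n => n <= absz z
  | GZ i z, GZ j w => i = j /\ (z == w + 1)%R || (w == z + 1)%R
  end.

Lemma adj_sym I (x y : gvertex I) : adj x y -> adj y x.
Proof.
case: x y => [c|n|i z] [d|m|j w] //=; first by case: c d => [] [].
  by rewrite orbC.
by move=> [-> h]; rewrite orbC.
Qed.

Definition relabel (I J : Type) (psi : I -> J) (x : gvertex I) : gvertex J :=
  match x with GC c => GC c | GN n => GN n | GZ i z => GZ (psi i) z end.

Lemma relabel_inj (I J : Type) (psi : I -> J) : injective psi -> injective (relabel psi).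
Proof. by move=> pI [c|n|i z] [d|m|k w] //= [] => [->|->|/pI-> ->]. Qed.

Lemma adj_relabel (I J : Type) (psi : I -> J) x y : injective psi ->
  adj x y <-> adj (relabel psi x) (relabel psi y).
Proof.
move=> pI; case: x y => [c|n|i z] [d|m|k w] //=.
by split=> -[e h]; split=> //; [rewrite e|exact: pI].
Qed.

(** Only at level 2 does the number 1 dominate: the neighbours there are 0, 1, 2 and levels 1 and 3.
    Level 1 has a neighbour of level 0, and levels from 3 on have the neighbour 3, neither of which
    is adjacent to 1. *)
Definition small_level I (x : gvertex I) := if x is GZ _ z then absz z == 2 else false.

Lemma adj_dominated I (i0 : I) (s y : gvertex I) : adj s y ->
  small_level s /\ y = GN 1 \/ exists x, [/\ adj x s, x <> y & ~ adj x y].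
Proof.
case: s y => [c|n|i z] [d|m|j w] //=.
- move=> h; right.
  case: c d h => [] [] //= _;
  first [by exists (GC vs)|by exists (GC vs')|by exists (GC t0)|
         by exists (GC t1)|by exists (GC t2)|by exists (GC t3)].
- by case: c => //= _; right;
    [exists (GC vs)|exists (GC vs')|exists (GC vs)|exists (GC vs')].
- by case: c => //= _; right; exists (GC vs').
(* Level [n + 2] is adjacent to [n] but too high for [t3], the only vertex of the finite part with
   neighbours in a copy. *)
- by move=> _; right; exists (GZ i0 n.+2); split=> //=; [lia|case: d].
- move=> h; right; have [on|en] := boolP (odd n).
    by exists (GC t3); split=> //=; lia.
  by exists (GC t0); split=> //=; lia.
- move=> h; right; have [on|en] := boolP (odd n).
    by exists (GC t1); split=> //=; rewrite on.
  by exists (GC t0).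
- by case: d => //= _; right; exists (GN 0).
- move=> h; have [m2|m2] := leqP 2 m.
    by right; exists (GN 0); split=> //=; [case: m h m2 => [|[]]|lia].
  case: m h m2 => [|[|//]] h _.
    have [z2|z2] := leqP 2 (absz z).
      by right; exists (GN 2).
    by right; exists (GC t3).
  have [z1|z1] := eqVneq (absz z) 1%N.
    by right; exists (GZ i 0); split=> //=; split=> //; lia.
  have [z2|z2] := eqVneq (absz z) 2; first by left; split=> //; apply/eqP.
  by right; exists (GN 3); split=> //=; lia.
(* The mirror image of [w] in [z]: the other neighbour of [z] within its copy. *)
- move=> [<- h]; right; exists (GZ i (z + z - w)); split=> //=.
  + by split=> //; lia.
  + by case; lia.
  + by case=> _; lia.
Qed.

Lemma adj_dominating I (s x : gvertex I) : small_level s -> adj x s ->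
  x = GN 1 \/ adj x (GN 1).
Proof.
case: s x => [//|//|i z] [c|n|j w] //= /eqP z2.
- by case: c => //=; rewrite z2.
- by case: n => [|[|[|n]]] //=; try (by left); try (by right); rewrite z2.
- by move=> [_ h]; right; lia.
Qed.

Section Param.
Variables (G : groupType) (S : set G) (I : Type) (v : gvertex I -> G).

Definition param :=
  [/\ injective v, range v = S & forall x y, adj x y <-> x <> y /\ commute (v x) (v y)].

End Param.

Lemma param_rigid (G : groupType) (S S2 : set G) (I : Type) (v : gvertex I -> G) :
  inhabited I -> racg S -> racg S2 -> span S = span S2 -> param S v ->
  exists v2 : gvertex I -> G, param S2 v2.
Proof.
move=> [i0] rS rS2 e [vi vr va].
have Sv x : S (v x) by rewrite -vr; exists x.
have commE x y : commute (v x) (v y) -> x = y \/ adj x y.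
  by move=> c; have [->|n] := pselect (x = y); [left|right; apply/va].
have adjE x y : adj x y -> commute (v x) (v y) by move=> /va[].
pose D := [set g | exists2 x, small_level x & v x = g].
have [||s y|s x|phi [h1 h2 h3 h4]] := @rigidity G S S2 rS rS2 e (v (GN 1)) D.
- exact: Sv.
- by move=> [x sx /vi ex]; rewrite ex in sx.
- rewrite -vr => -[x _ <-] [y' _ <-] ne /commE[e'|a]; first by rewrite e' in ne.
  have [[sl ->]|[x' [a1 n1 n2]]] := adj_dominated i0 a.
    by left; split=> //; exists x.
  right; exists (v x'); split=> //; [exact: adjE|by move=> /vi|].
  by move=> /commE[].
- rewrite -vr => -[s' _ <-] [x' _ <-] [s2 sl /vi es] /commE[->|a].
    apply: adjE; subst s'; case: s2 sl => //= i z /eqP ->; exact: isT.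
  rewrite -es in a.
  by have [->|a1] := adj_dominating sl a; [exact: commute_refl|exact: adjE].
exists (phi \o v); split.
- by move=> x y /= /h2 ee; apply/vi/ee; exact: Sv.
- apply/seteqP; split=> [g [x _ <-]|g]; first by apply/h1/Sv.
  by move=> /h3[s]; rewrite -vr => -[x _ <-] <-; exists x.
- by move=> x y; rewrite va /= h4.
Qed.

(** * Embeddings between the graphs *)

Section Embedding.
Variables (I J : Type) (j : gvertex I -> gvertex J).
Hypotheses (jI : injective j) (jA : forall x y, adj x y <-> adj (j x) (j y)).
Hypothesis uncI : ~ exists f : I -> nat, injective f.

Lemma embed_no_code (f : I -> gvertex J) (T : countType) (g : gvertex J -> T) :
  injective f -> ~ {in range f &, injective g}.
Proof.
move=> fI gI; apply: uncI; exists (pickle \o g \o f) => x y /=.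
move=> /(pcan_inj (@pickleK T)) e; apply/fI/gI => //; apply/mem_set.
  by exists x.
by exists y.
Qed.

(** The copy is forgotten, so this is injective on any set of vertices that meets at most one
    copy. *)
Definition code (y : gvertex J) : bool * bool * nat * int :=
  match y with
  | GC c =>
      (true, false,
       match c with vs => 0 | vs' => 1%N | t0 => 2 | t1 => 3 | t2 => 4 | t3 => 5 end,
       0%R)
  | GN n => (false, false, n, 0%R)
  | GZ _ z => (false, true, 0, z)
  end.

Definition heavy (y : gvertex J) := if y is (GC t3 | GN _) then True else False.

(** A vertex other than [t3] and the numbers has neighbours in at most one copy, hence only
    countably many. *)
Lemma embed_uncountable_degree x (f : I -> gvertex I) : injective f ->
  (forall i, adj x (f i)) ->
  heavy (j x).
Proof.
move=> fI fA.
have fjI : injective (j \o f) by move=> a b /jI/fI.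
have fjA i : adj (j x) ((j \o f) i) by apply/jA.
case E : (j x) => [c|//|k z]; last first.
  apply: (embed_no_code (g := code) fjI) => a b /set_mem[i _ <-] /set_mem[i' _ <-].
  move: (fjA i) (fjA i'); rewrite E; move: ((j \o f) i) ((j \o f) i').
  move=> [c|n|k1 z1] [d|m|k2 z2] //= => [_ _|_ _ [->]//|[<- _] [<- _] [->]//].
  by case: c d => [] [].
case: c E => // E;
  apply: (embed_no_code (g := code) fjI) => a b /set_mem[i _ <-] /set_mem[i' _ <-];
  move: (fjA i) (fjA i'); rewrite E; move: ((j \o f) i) ((j \o f) i');
  move=> [c|n|k1 z1] [d|m|k2 z2] //=;
  by [move=> _ _ [->]|case: c d => [] []].
Qed.

(** A number has at most three neighbours of uncountable degree, namely [t3] and two numbers,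
    whereas the images of 1, 3, 5 and 7 would be four. *)
Lemma embed_t3 : j (GC t3) = GC t3.
Proof.
have jN n : heavy (j (GN n)).
  have := @embed_uncountable_degree (GN n) (fun i => GZ i (Posz n)).
  by apply=> [a b []//|i] /=; lia.
have := @embed_uncountable_degree (GC t3) (fun i => GZ i 0).
case E : (j (GC t3)) => [[]|m|] // h; try by exfalso; apply: h => // a b [].
exfalso; have key n : odd n -> j (GN n) = GC t3 \/ j (GN n) = GN m.+1 \/ j (GN n) = GN m.-1.
  move=> on; have : adj (GC t3) (@GN I n) by [].
  move=> /jA; rewrite E; have := jN n.
  case: (j (GN n)) => [[]|k|] //= _; first by left.
  by move=> /orP[/eqP->|/eqP->]; right; [right|left].
have ne a b : a <> b -> j (GN a) <> j (GN b) by move=> ab /jI[].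
have /(_ isT) k1 := key 1%N; have /(_ isT) k3 := key 3.
have /(_ isT) k5 := key 5; have /(_ isT) k7 := key 7.
have [n13 [n15 n17]] : j (GN 1) <> j (GN 3) /\ j (GN 1) <> j (GN 5) /\ j (GN 1) <> j (GN 7).
  by do !split; exact: ne.
have [n35 [n37 n57]] : j (GN 3) <> j (GN 5) /\ j (GN 3) <> j (GN 7) /\ j (GN 5) <> j (GN 7).
  by do !split; exact: ne.
by move: k1 k3 k5 k7 => [?|[?|?]] [?|[?|?]] [?|[?|?]] [?|[?|?]]; congruence.
Qed.

(** The numbers form a one-ended path, which embeds into itself only by a translation; [t3] sees
    exactly the odd numbers, so the translation is even. *)
Lemma embed_shift : exists c, ~~ odd c /\ forall n, j (GN n) = GN (c + n).
Proof.
have /choice[f fE] : forall n, exists k, j (GN n) = GN k.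
  move=> n; have := @embed_uncountable_degree (GN n) (fun i => GZ i (Posz n)).
  case E : (j (GN n)) => [[]|k|] // h; try by [exists k];
    try by (exfalso; apply: h => [a b []//|i /=]; lia).
  by have := jI (etrans E (esym embed_t3)).
have fI : injective f.
  by move=> a b e; have [] : @GN I a = GN b by apply: jI; rewrite !fE e.
have fA a b : (a == b.+1) || (b == a.+1) = (f a == (f b).+1) || (f b == (f a).+1).
  by have := jA (GN a) (GN b); rewrite !fE /= => h; apply/idP/idP => /h.
have fodd n : odd (f n) = odd n.
  have := jA (GC t3) (GN n); rewrite fE embed_t3 /= => h.
  by apply/idP/idP => /h.
have up : f 1%N = (f 0).+1.
  have := fA 1%N 0; rewrite /= => /esym/orP[/eqP//|/eqP f01]; exfalso.
  have dn n : f n + n = f 0.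
    elim/ltn_ind: n => -[|[|n]] IH; [by rewrite addn0|by rewrite f01 addn1|].
    have h0 := IH n (leqW (ltnSn n)); have h1 := IH n.+1 (ltnSn _).
    have := fA n.+2 n.+1; rewrite eqxx /= => /esym/orP[/eqP h|/eqP h].
      have : f n.+2 = f n by lia.
      by move=> /fI; lia.
    by lia.
  by have := dn (f 0).+1; lia.
have fn n : f n = f 0 + n.
  elim/ltn_ind: n => -[|[|n]] IH; [by rewrite addn0|by rewrite up addn1|].
  have h0 := IH n (leqW (ltnSn n)); have h1 := IH n.+1 (ltnSn _).
  have := fA n.+2 n.+1; rewrite eqxx /= => /esym/orP[/eqP h|/eqP h]; first by lia.
  have : f n.+2 = f n by lia.
  by move=> /fI; lia.
by exists (f 0); split=> [|n]; [rewrite fodd|rewrite fE fn].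
Qed.

(** The even neighbour 2 of [t1] excludes a nonzero shift. Adjacency to infinitely many even or odd
    numbers, and then to [t3], tells the [t] vertices apart. *)
Lemma embed_std : (forall c, j (GC c) = GC c) /\ forall n, j (GN n) = GN n.
Proof.
have [c [ec jN]] := embed_shift; have j3 := embed_t3.
have adjN x n : adj x (GN n) <-> adj (j x) (GN (c + n)) by rewrite jA jN.
have notN x k : (forall n, adj x (GN n.*2)) \/ (forall n, adj x (GN n.*2.+1)) -> j x <> GN k.
  by case=> h e; have := h 0; have := h 1%N; have := h 2; rewrite !adjN e /=; lia.
have notZ x i z : (forall n, adj x (GN n.*2)) \/ (forall n, adj x (GN n.*2.+1)) -> j x <> GZ i z.
  by case=> h e; have := h (absz z).+1; rewrite adjN e /=; lia.
have ev d : (forall n, adj (@GC I d) (GN n.*2)) -> j (GC d) = GC t0 \/ j (GC d) = GC t2.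
  (* The number [c + 8] is even and different from 2, so [t1] is ruled out. *)
  move=> h; have := h 4; rewrite adjN.
  case E : (j (GC d)) => [[]|k|i z] //=; try by [left|right|lia].
    by case: (notN (GC d) k _ E); left.
  by case: (notZ (GC d) i z _ E); left.
have od d : (forall n, adj (@GC I d) (GN n.*2.+1)) -> j (GC d) = GC t1 \/ j (GC d) = GC t3.
  move=> h; have := h 4; rewrite adjN.
  case E : (j (GC d)) => [[]|k|i z] //=; try by [left|right|lia].
    by case: (notN (GC d) k _ E); right.
  by case: (notZ (GC d) i z _ E); right.
have j2 : j (GC t2) = GC t2.
  have [|e|//] := ev t2; first by move=> n /=; lia.
  by have /jA : adj (@GC I t2) (GC t3) by []; rewrite e j3.
have j0 : j (GC t0) = GC t0.
  have [|//|e] := ev t0; first by move=> n /=; lia.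
  by have := jI (etrans e (esym j2)).
have j1 : j (GC t1) = GC t1.
  have [|//|e] := od t1; first by move=> n /=; lia.
  by have := jI (etrans e (esym j3)).
have c0 : c = 0.
  by have /adjN : adj (@GC I t1) (GN 2) by []; rewrite j1 /=; lia.
have jN' n : j (GN n) = GN n by rewrite jN c0.
have noN d n : j (GC d) <> GN n by rewrite -jN' => /jI.
have js : j (GC vs) = GC vs.
  have /jA : adj (@GC I vs) (GC t0) by []; have /jA : adj (@GC I vs) (GC t2) by [].
  rewrite j0 j2; case E : (j (GC vs)) => [[]|k|i z] //=.
  by case: (noN vs k).
have js' : j (GC vs') = GC vs'.
  have /jA : adj (@GC I vs') (GC t1) by []; have /jA : adj (@GC I vs') (GC t3) by [].
  rewrite j1 j3; case E : (j (GC vs')) => [[]|k|i z] //=.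
  by case: (noN vs' k).
by split=> // -[].
Qed.

(** The level of a vertex is the largest number adjacent to it, so it is preserved, and
    connectedness keeps each copy inside one copy. By injectivity, [w] and [- w] then map onto the
    two vertices of their level. *)
Lemma embed_theta : exists theta : I -> J, injective theta /\
  (forall i z, exists2 w, j (GZ i z) = GZ (theta i) w & absz w = absz z) /\
  (forall i w, exists z, j (GZ i z) = GZ (theta i) w).
Proof.
have [jC jN] := embed_std.
have jZ i z : exists k w, j (GZ i z) = GZ k w /\ absz w = absz z.
  case E : (j (GZ i z)) => [c|n|k w].
  - by have := jI (etrans E (esym (jC c))).
  - by have := jI (etrans E (esym (jN n))).
  exists k, w; split=> //.
  have h n : (n <= absz z) = (n <= absz w).
    by have := jA (GN n) (GZ i z); rewrite E jN /= => h; apply/idP/idP => /h.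
  by have := h (absz z); have := h (absz w); lia.
have /choice[theta thE] : forall i, exists k, exists w, j (GZ i 0) = GZ k w.
  by move=> i; have [k [w [e _]]] := jZ i 0%R; exists k, w.
have step i z k w w' k' : j (GZ i z) = GZ k w -> j (GZ i (z + 1)%R) = GZ k' w' -> k = k'.
  move=> e e'; have : adj (GZ i z) (GZ i (z + 1)%R) by split=> //; rewrite eqxx orbT.
  by rewrite jA e e' /= => -[].
have all i z : exists2 w, j (GZ i z) = GZ (theta i) w & absz w = absz z.
  have [w0 e0] := thE i.
  have pos n : exists w, j (GZ i (Posz n)) = GZ (theta i) w.
    elim: n => [|n [w IH]]; first by exists w0.
    have [k [w' [e _]]] := jZ i (Posz n.+1).
    have e' : j (GZ i (Posz n + 1)%R) = GZ k w' by rewrite -e; congr (j (GZ _ _)); lia.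
    by exists w'; rewrite (step _ _ _ _ _ _ IH e').
  have neg n : exists w, j (GZ i (- Posz n)%R) = GZ (theta i) w.
    elim: n => [|n [w IH]]; first by exists w0.
    have [k [w' [e _]]] := jZ i (- Posz n.+1)%R.
    have e' : j (GZ i (- Posz n.+1 + 1)%R) = GZ (theta i) w.
      by rewrite -IH; congr (j (GZ _ _)); lia.
    by exists w'; rewrite -(step _ _ _ _ _ _ e e').
  have [w e] : exists w, j (GZ i z) = GZ (theta i) w.
    by case: (intP z) => [|n|n]; [exists w0|exact: pos|exact: neg].
  exists w => //; have [k [w' [e' h]]] := jZ i z.
  by move: e; rewrite e' => -[_ <-].
exists theta; split.
  move=> a b e; have [w ea ha] := all a 0%R; have [w' eb hb] := all b 0%R.
  have ww : w = w' by lia.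
  by have [] : GZ a 0 = GZ b 0 by apply: jI; rewrite ea eb e ww.
split=> // i w; have [w1 e1 h1] := all i w; have [w2 e2 h2] := all i (- w)%R.
have [ew|nw] := eqVneq w1 w; first by exists w; rewrite e1 ew.
exists (- w)%R; rewrite e2; congr GZ.
have [//|n2] := eqVneq w2 w.
have e12 : w1 = w2 by lia.
have : GZ i w = GZ i (- w)%R by apply: jI; rewrite e1 e2 e12.
by case=> ew; lia.
Qed.

End Embedding.

(** * Models of the theory of the successor *)

Lemma inj_surj_bijective (T U : Type) (f : T -> U) :
  injective f -> (forall y, exists x, f x = y) -> bijective f.
Proof.
move=> fI /choice[g gE]; exists g => [x|y]; last exact: gE.
by apply: fI; rewrite gE.
Qed.

Lemma sval_injective (T : Type) (P : T -> Prop) : injective (@sval T P).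
Proof. by move=> [x p] [y q] /= e; subst y; congr exist; exact: Prop_irrelevance. Qed.

Section Models.
Variable B : sstruct.
Hypothesis modB : models B (Th nat_sstruct).
Local Notation succ := (@ssucc B).

Let ax p : sentence p -> satisfies nat_sstruct p -> holds (fun _ => szero B) p.
Proof. by move=> sp np; apply: modB. Qed.

Lemma succ_inj : injective succ.
Proof.
have := @ax (All (All (Imp (Eq (Succ (Var 0)) (Succ (Var 1))) (Eq (Var 0) (Var 1))))).
move=> h x y e; have := h isT _ y x e; apply.
by move=> ? a b /= [].
Qed.

Lemma succ_neq0 b : succ b <> szero B.
Proof.
by have := @ax (All (Imp (Eq (Succ (Var 0)) Zero) Fls)); apply=> // ? [|n].
Qed.

Lemma succ_pred b : b <> szero B -> exists c, succ c = b.
Proof.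
move=> b0; apply: contrapT => no.
have := @ax (All (Imp (Imp (Eq (Var 0) Zero) Fls)
  (Imp (All (Imp (Eq (Succ (Var 0)) (Var 1)) Fls)) Fls))).
move=> /(_ isT) h; apply: (h _ b b0) => [e [|n] //= _ h'|c e].
  exact: (h' n).
by apply: no; exists c.
Qed.

Lemma succ_acyclic n b : iter n.+1 succ b <> b.
Proof.
have := @ax (All (Imp (Eq (iter n.+1 Succ (Var 0)) (Var 0)) Fls)).
have tev (A : sstruct) (e : nat -> A) m :
    teval e (iter m Succ (Var 0)) = iter m (@ssucc A) (e 0).
  by elim: m => //= m ->.
have tb m : term_below 1 (iter m Succ (Var 0)) by elim: m.
move=> h; have /h : sentence (All (Imp (Eq (iter n.+1 Succ (Var 0)) (Var 0)) Fls)).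
  by rewrite /sentence /= tb.
move=> {}h; have := h _ b; rewrite /= tev; apply.
move=> e m /=; rewrite tev /= => em.
have itE k : iter k (@ssucc nat_sstruct) m = (k + m)%N by elim: k => //= k ->.
by move: em; rewrite itE /=; lia.
Qed.

Lemma iter_succ_inj n : injective (iter n succ).
Proof. by elim: n => [//|n IH] x y /= /succ_inj/IH. Qed.

Lemma std_inj : injective (std B).
Proof.
have key m n : m <= n -> std B m = std B n -> m = n.
  move=> /subnK <-; rewrite addnC /std iterD => /iter_succ_inj.
  case: (n - m) => [|k] e; first by rewrite addn0.
  by case: (@succ_neq0 (iter k succ (szero B))).
move=> m n e; case: (leqP m n) => [/key->//|/ltnW/key h].
by rewrite h.
Qed.

Lemma standard_succ b : standard (succ b) -> standard b.
Proof.
by move=> [[|n] _ /= e]; [case: (@succ_neq0 b)|exists n => //; exact: succ_inj].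
Qed.

Let prd_ex : forall b, exists c, b <> szero B -> succ c = b.
Proof.
move=> b; have [->|n] := pselect (b = szero B); first by exists (szero B).
by have [c e] := succ_pred n; exists c.
Qed.

Let prd := projT1 (choice prd_ex).

Lemma succ_prd b : ~ standard b -> succ (prd b) = b.
Proof.
rewrite /prd; case: choice => f /= h nb; apply: h => e; apply: nb.
by exists 0.
Qed.

(** [prd] is arbitrary at zero; starting from a nonstandard [o], zero is never reached. *)
Definition shift (o : B) (z : int) : B :=
  match z with Posz n => iter n succ o | Negz n => iter n.+1 prd o end.

Lemma prd_nonstd b : ~ standard b -> ~ standard (prd b).
Proof.
move=> nb [k _ e]; have := succ_prd nb; rewrite -e => h; apply: nb.
by exists k.+1.
Qed.

Lemma iter_prd_nonstd n o : ~ standard o -> ~ standard (iter n prd o).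
Proof. by move=> no; elim: n => [//|n IH] /=; exact: prd_nonstd. Qed.

Lemma iter_succ_nonstd n o : ~ standard o -> ~ standard (iter n succ o).
Proof. by move=> no; elim: n => [//|n IH] /= /standard_succ. Qed.

Lemma shift_nonstd o z : ~ standard o -> ~ standard (shift o z).
Proof.
by case: z => n no; [exact: iter_succ_nonstd|exact: iter_prd_nonstd].
Qed.

Lemma shiftS o z : ~ standard o -> shift o (z + 1)%R = succ (shift o z).
Proof.
move=> no; case: z => n.
  by have -> : (Posz n + 1)%R = Posz n.+1 by lia.
have -> : shift o (Negz n + 1)%R = iter n prd o.
  case: n => [|n]; first by [].
  by have -> : (Negz n.+1 + 1)%R = Negz n by lia.
by rewrite /= succ_prd //; exact: iter_prd_nonstd.
Qed.

Lemma shiftD o z n : ~ standard o -> shift o (z + Posz n)%R = iter n succ (shift o z).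
Proof.
move=> no; elim: n => [|n IH]; first by rewrite GRing.addr0.
have -> : (z + Posz n.+1)%R = (z + Posz n + 1)%R by lia.
by rewrite shiftS // IH.
Qed.

Lemma shift_inj o : ~ standard o -> injective (shift o).
Proof.
move=> no; have key z w : (z <= w)%R -> shift o z = shift o w -> z = w.
  move=> zw; have [n ->] : exists n, w = (z + Posz n)%R by exists (absz (w - z)%R); lia.
  rewrite shiftD //; case: n => [|n] e; first by lia.
  by case: (@succ_acyclic n (shift o z)).
move=> z w e; have [zw|wz] : (z <= w)%R \/ (w <= z)%R by lia.
  exact: key.
by apply/esym/key.
Qed.

Lemma at_distP o n b : ~ standard o ->
  at_dist o n b <-> exists2 z, absz z = n & b = shift o z.
Proof.
move=> no; split=> [[->|e]|[z <- ->]].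
- by exists (Posz n).
- exists (- Posz n)%R; first by lia.
  apply: (@iter_succ_inj n); rewrite e -shiftD //.
  by have -> : (- Posz n + Posz n)%R = 0%R by lia.
have [z0|z0] : (0 <= z)%R \/ (z < 0)%R by lia.
  by left; have := shiftD 0 (absz z) no => <-; congr shift; lia.
by right; rewrite -shiftD //; have -> : (z + Posz (absz z))%R = 0%R by lia.
Qed.

Variables (O : set B) (I : Type) (o : I -> B).
Hypotheses (orgO : is_origins O) (oI : injective o) (Oo : O = range o).

Let onon i : ~ standard (o i).
Proof. by apply: (proj1 orgO); rewrite Oo; exists i. Qed.

Let OoI i : O (o i).
Proof. by rewrite Oo; exists i. Qed.

Definition gamma_of (x : gvertex I) : vertex (Gamma O) :=
  match x with
  | GC c => inl c
  | GN n => inr (std B n)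
  | GZ i z => inr (shift (o i) z)
  end.

Lemma shift_origin i j z w : shift (o i) z = shift (o j) w -> i = j.
Proof.
move=> e; have nb := shift_nonstd (z := z) (@onon i).
have [o' [_ uo]] := proj2 orgO _ nb; apply: oI.
rewrite -(uo (o i)); last first.
  by split=> //; exists (absz z); apply/at_distP => //; exists z.
apply: uo; split=> //; exists (absz w); apply/at_distP => //.
by exists w.
Qed.

Lemma gamma_of_inj : injective gamma_of.
Proof.
move=> [c|n|i z] [d|m|j w] //= [].
- by move=> ->.
- by move=> /std_inj ->.
- by move=> e; case: (shift_nonstd (z := w) (@onon j)); exists n.
- by move=> e; case: (shift_nonstd (z := z) (@onon i)); exists m.
- move=> e; have ij := shift_origin e; subst j; congr GZ.
  by apply: (shift_inj (@onon i)).
Qed.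

Lemma nonstd_shift b : ~ standard b -> exists i z, b = shift (o i) z.
Proof.
move=> nb; have [o' [[Oo' [n h]] _]] := proj2 orgO b nb.
move: Oo' h; rewrite Oo => -[i _ <-] /at_distP[//|z _ ->].
by exists i, z.
Qed.

Lemma gamma_of_surj y : exists x, gamma_of x = y.
Proof.
case: y => [c|b]; first by exists (GC c).
have [[n _ <-]|/nonstd_shift[i [z ->]]] := pselect (standard b).
  by exists (GN n).
by exists (GZ i z).
Qed.

Lemma gamma_arc_adj X Y : Gamma_arc O X Y ->
  exists x y, [/\ gamma_of x = X, gamma_of y = Y & adj x y].
Proof.
case.
- by move=> c d h; exists (GC c), (GC d); split=> //; case: h.
- by move=> n h; exists (GC t0), (GN n).
- by move=> n h; exists (GC t2), (GN n).
- by exists (GC t1), (GN 2).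
- by move=> n h; exists (GC t1), (GN n); split=> //=; rewrite h.
- by move=> n h; exists (GC t3), (GN n).
- by move=> n; exists (GN n), (GN n.+1); split=> //=; rewrite eqxx orbT.
- move=> b /nonstd_shift[i [z ->]]; exists (GZ i z), (GZ i (z + 1)%R).
  by split=> //=; rewrite ?shiftS // eqxx orbT.
- move=> o' n b m; rewrite Oo => -[i _ <-] /at_distP[//|z <- ->] h.
  by exists (GZ i z), (GN m).
- move=> o' n b; rewrite Oo => -[i _ <-] /at_distP[//|z <- ->] h.
  by exists (GC t3), (GZ i z).
Qed.

Lemma adj_gamma x y : adj x y <-> edge (gamma_of x) (gamma_of y).
Proof.
split; last first.
  move=> [/gamma_arc_adj|/gamma_arc_adj] [x' [y' [/gamma_of_inj <- /gamma_of_inj <-]]] //.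
  exact: adj_sym.
have key i z n : n <= absz z -> Gamma_arc O (inr (shift (o i) z)) (inr (std B n)).
  by move=> h; apply: (@arc_Z_std _ _ (o i) (absz z)) => //; apply/at_distP => //; exists z.
have keyC c n : adjCN c n -> Gamma_arc O (inl c) (inr (std B n)).
  by case: c => //= h; try (by constructor); case/orP: h => [|/eqP ->]; constructor.
have keyZ c i z : adjCZ c z -> Gamma_arc O (inl c) (inr (shift (o i) z)).
  case: c => //= h; apply: (@arc_t3_Z _ _ (o i) (absz z)) => //.
  by apply/at_distP => //; exists z.
case: x y => [c|n|i z] [d|m|j w] //=.
- case: c d => [] [] //= _; by [left; constructor; constructor|
    right; constructor; constructor].
- by move=> /keyC; left.
- by move=> /keyZ; left.
- by move=> /keyC; right.
- by move=> /orP[/eqP->|/eqP->]; [right|left]; constructor.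
- by move=> /key; right.
- by move=> /keyZ; right.
- by move=> /key; left.
- move=> [<- /orP[/eqP->|/eqP->]]; rewrite shiftS //; [right|left];
    by constructor; exact: shift_nonstd.
Qed.

Lemma iso_param (G : groupType) (S : set G) :
  graph_iso (Coxeter_graph S) (Gamma O) <-> exists v : gvertex I -> G, param S v.
Proof.
split=> [[f [[g fg gf] fE]]|[v [vI vr va]]].
  exists (fun x => sval (g (gamma_of x))); split.
  - by move=> x y /= /sval_injective/(can_inj gf)/gamma_of_inj.
  - apply/seteqP; split=> [_ [x _ <-]|s Ss]; first exact: svalP.
    have [x e] := gamma_of_surj (f (exist _ s Ss)).
    by exists x => //; rewrite e fg.
  - move=> x y; rewrite adj_gamma -{1}(gf (gamma_of x)) -{1}(gf (gamma_of y)) -fE /=.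
    split=> -[h c]; split=> //; first by move=> e; apply: h; rewrite e.
    by move=> /sval_injective/(can_inj gf)/gamma_of_inj.
have /choice[u uE] : forall x : {x | S x}, exists y, v y = sval x.
  move=> [x Sx] /=; have [y _ e] : range v x by rewrite vr.
  by exists y.
exists (gamma_of \o u); split.
  apply: inj_surj_bijective => [x y /gamma_of_inj e|y].
    by apply: sval_injective; rewrite -!uE e.
  have [x <-] := gamma_of_surj y.
  have Sx : S (v x) by rewrite -vr; exists x.
  exists (exist _ (v x) Sx); congr gamma_of; apply: vI; exact: uE.
move=> x y; rewrite -adj_gamma va !uE /=.
split=> -[h c]; split=> //; first by move=> e; apply: h; rewrite -!uE e.
by move=> e; apply: h; apply: vI; rewrite !uE.
Qed.

End Models.

(** * Successor models with a prescribed set of copies, and their elementary equivalence *)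

Definition zmodel (I : Type) : sstruct :=
  @SStruct (nat + I * int)%type (inl 0)
    (fun b => match b with inl n => inl n.+1 | inr (i, z) => inr (i, (z + 1)%R) end).

Lemma holds_iso (A B : sstruct) (f : A -> B) :
  injective f -> (forall y, exists x, f x = y) ->
  f (szero A) = szero B -> (forall x, f (ssucc x) = ssucc (f x)) ->
  forall p e, holds e p <-> holds (f \o e) p.
Proof.
move=> fI fs f0 fS; have tev e t : teval (f \o e) t = f (teval e t).
  by elim: t => //= t ->.
elim=> [t u|//|p IHp q IHq|p IH] e /=.
- by rewrite !tev; split=> [->//|/fI].
- by rewrite IHp IHq.
- have ce x : f \o env_cons x e = env_cons (f x) (f \o e) by apply/funext => -[].
  split=> h y; last by rewrite IH ce.
  by have [x <-] := fs y; rewrite -ce -IH.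
Qed.

Definition inf_type (I : eqType) := forall L : seq I, exists i, i \notin L.

Section BackForth.

(** A finite list of paired copies encodes a partial isomorphism that is the identity on the
    standard part and on integer coordinates. It commutes with the successor automatically, so a
    back-and-forth step only has to pair one fresh copy. *)
Definition matched (I J : eqType) (L : seq (I * J)) (x : zmodel I) (y : zmodel J) :=
  match x, y with
  | inl n, inl m => n = m
  | inr (i, z), inr (j, w) => (i, j) \in L /\ z = w
  | _, _ => False
  end.

Definition partial_inj (I J : eqType) (L : seq (I * J)) :=
  forall i i' j j', (i, j) \in L -> (i', j') \in L -> (i = i' <-> j = j').

Lemma matched_ext (I J : eqType) (L : seq (I * J)) (x : zmodel I) :
  inf_type J -> partial_inj L ->
  exists y L', [/\ {subset L <= L'}, partial_inj L' & matched L' x y].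
Proof.
move=> infJ pL; case: x => [n|[i z]]; first by exists (inl n), L; split.
have [[j ij]|no] := pselect (exists j, (i, j) \in L).
  by exists (inr (j, z)), L; split.
have [j nj] := infJ (unzip2 L); exists (inr (j, z)), ((i, j) :: L); split.
- by move=> x xL; rewrite in_cons xL orbT.
- have nj' i1 : (i1, j) \notin L.
    by apply: contra nj => h; apply/mapP; exists (i1, j).
  have ni j1 : (i, j1) \notin L by apply/negP => h; apply: no; exists j1.
  move=> i1 i2 j1 j2; rewrite !in_cons => /orP[/eqP[-> ->]|h1] /orP[/eqP[-> ->]|h2].
  + by [].
  + by split=> e; subst; [case/negP: (ni j2)|case/negP: (nj' i2)].
  + by split=> e; subst; [case/negP: (ni j1)|case/negP: (nj' i1)].
  + exact: pL.
- by rewrite /= mem_head.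
Qed.

Lemma matched_sym (I J : eqType) (L : seq (I * J)) x y :
  matched [seq (p.2, p.1) | p <- L] y x <-> matched L x y.
Proof.
have memE i j : ((j, i) \in [seq (p.2, p.1) | p <- L]) = ((i, j) \in L).
  by apply/mapP/idP => [[[a b] h [-> ->]]|h]; [|exists (i, j)].
case: x y => [n|[i z]] [m|[j w]] //=; first by split.
by rewrite memE; split=> -[].
Qed.

Lemma holds_zmodel (I J : eqType) : inf_type I -> inf_type J ->
  forall p (L : seq (I * J)) (e : nat -> zmodel I) (e' : nat -> zmodel J),
  partial_inj L -> (forall k, matched L (e k) (e' k)) -> holds e p <-> holds e' p.
Proof.
move=> infI infJ; elim=> [t u|//|p IHp q IHq|p IH] L e e' pL m /=.
- have tev t' : matched L (teval e t') (teval e' t').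
    elim: t' => //= t'; case: (teval e t') => [n|[i z]];
    by case: (teval e' t') => [k|[j w]] //=; first [by move=> ->|by move=> [? ->]].
  move: (tev t) (tev u); case: (teval e t) => [n|[i z]];
    case: (teval e' t) => [n'|[i' z']] //=; case: (teval e u) => [k|[j w]];
    case: (teval e' u) => [k'|[j' w']] //=; first by move=> -> ->; split=> -[->].
  by move=> [h1 ->] [h2 ->]; have := pL _ _ _ _ h1 h2 => h3; split=> -[/h3 -> ->].
- by rewrite (IHp L e e') // (IHq L e e').
- have mono L' x y : {subset L <= L'} -> matched L x y -> matched L' x y.
    by move=> sub; case: x y => [n|[i z]] [n'|[i' z']] //= [/sub].
  split=> h y.
    have pL' : partial_inj [seq (p.2, p.1) | p <- L].
      by move=> i i' j j' /mapP[[a b] h1 [-> ->]] /mapP[[a' b'] h2 [-> ->]] /=;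
         have := pL _ _ _ _ h1 h2 => ->.
    have [x [L' [sub pL2 mx]]] := matched_ext y infI pL'.
    have pL3 : partial_inj [seq (p.2, p.1) | p <- L'].
      by move=> i i' j j' /mapP[[a b] h1 [-> ->]] /mapP[[a' b'] h2 [-> ->]] /=;
         have := pL2 _ _ _ _ h1 h2 => ->.
    apply/(IH _ (env_cons x e) _ pL3); last exact: h.
    move=> [|k] /=; apply/matched_sym => //.
    have /matched_sym := m k.
    move: (e k) (e' k) => [n|[i z]] [n'|[i' z']] //= [h1 h2].
    by split=> //; apply: sub.
  have [x [L' [sub pL' mx]]] := matched_ext y infJ pL.
  apply/(IH L' _ (env_cons x e') pL'); last exact: h.
  by move=> [|k] //=; apply: mono (m k).
Qed.

End BackForth.

Lemma holds_below (B : sstruct) p k (e e' : nat -> B) :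
  formula_below k p -> (forall i, i < k -> e i = e' i) -> holds e p <-> holds e' p.
Proof.
elim: p k e e' => [t u|//|p IHp q IHq|p IH] k e e' /=.
- have tev t' : term_below k t' -> (forall i, i < k -> e i = e' i) ->
      teval e t' = teval e' t'.
    by move=> h he; elim: t' h => //= t' IH /IH ->.
  by move=> /andP[ht hu] he; rewrite !tev.
- by move=> /andP[hp hq] he; rewrite (IHp k e e') // (IHq k e e').
- move=> hp he; split=> h x.
    by apply/(IH k.+1 (env_cons x e)) => // -[|i] //= /he.
  by apply/(IH k.+1 _ (env_cons x e')) => // -[|i] //= /he.
Qed.

(** For a sentence the environment may be taken constantly zero, where the empty matching starts the
    back-and-forth. *)
Lemma zmodel_models (I J : eqType) : inf_type I -> inf_type J ->
  models (zmodel I) (Th nat_sstruct) -> models (zmodel J) (Th nat_sstruct).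
Proof.
move=> infI infJ h p hp e; have [sp _] := hp.
apply/(holds_below (k := 0) (e' := fun _ => szero (zmodel J)) sp) => //.
have := @holds_zmodel I J infI infJ p [::] (fun _ => szero (zmodel I))
  (fun _ => szero (zmodel J)).
by case=> // h1 _; apply: h1; apply: h.
Qed.

Lemma models_zmodel (B : sstruct) (O : set B) : models B (Th nat_sstruct) ->
  is_origins O -> models (zmodel {o | O o}) (Th nat_sstruct).
Proof.
move=> mB oO p hp e.
have onon (i : {o | O o}) : ~ standard (sval i) by apply: (proj1 oO); exact: svalP.
have sI := @sval_injective _ O.
have Oo : O = range (@sval _ O).
  by apply/seteqP; split=> [x Ox|_ [x _ <-]]; [exists (exist _ x Ox)|exact: svalP].
pose f (x : zmodel {o | O o}) : B := match x with inl n => std B n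
  | inr (i, z) => shift mB (sval i) z end.
apply/(@holds_iso _ _ f); last by have := mB p hp; apply.
- move=> x y e'; have := @gamma_of_inj _ mB O _ _ oO sI Oo
    (match x with inl n => GN n | inr (i, z) => GZ i z end)
    (match y with inl n => GN n | inr (i, z) => GZ i z end).
  by move: e'; case: x => [n|[i z]]; case: y => [m|[j w]] /= -> /(_ erefl) [] //;
    move=> -> // ->.
- move=> y; have [x] := @gamma_of_surj _ mB O _ _ oO Oo (inr y).
  by case: x => [c|n|i z] //= [<-]; [exists (inl n)|exists (inr (i, z))].
- by [].
- by move=> [n|[i z]] //=; rewrite shiftS.
Qed.

Lemma iter_zmodel (I : Type) n (i : I) z :
  iter n (@ssucc (zmodel I)) (inr (i, z)) = inr (i, (z + Posz n)%R).
Proof.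
elim: n => [|n IH]; first by rewrite GRing.addr0.
by rewrite iterS IH /=; congr (inr (_, _)); lia.
Qed.

Lemma std_zmodel (I : Type) n : std (zmodel I) n = inl n.
Proof. by rewrite /std; elim: n => //= n ->. Qed.

Lemma zmodel_origins (I : Type) :
  @is_origins (zmodel I) (range (fun i : I => inr (i, 0%R))).
Proof.
split=> [_ [i _ <-] [n _]|[n|[i z]] nb]; first by rewrite std_zmodel.
  by case: nb; exists n => //; rewrite std_zmodel.
exists (inr (i, 0%R)); split.
  split; first by exists i.
  exists (absz z); rewrite /at_dist !iter_zmodel.
  have [h|h] : (0 <= z)%R \/ (z < 0)%R by lia.
    by left; congr (inr (_, _)); lia.
  by right; congr (inr (_, _)); lia.
move=> _ [[j _ <-] [n]]; rewrite /at_dist !iter_zmodel.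
by case=> -[-> _].
Qed.

Lemma inf_nat : inf_type nat.
Proof.
have le_sumn (M : seq nat) y : y \in M -> y <= sumn M.
  elim: M => [//|x M IH] /=; rewrite in_cons => /orP[/eqP->|/IH h].
    exact: leq_addr.
  by rewrite (leq_trans h) // leq_addl.
by move=> L; exists (sumn L).+1; apply/negP => /le_sumn; rewrite ltnn.
Qed.

(** * Automorphisms fixing the standard part *)

(** Each new point costs one transposition, of its current value with the prescribed one. Only
    points of [U] and of its image move, which later leaves the copies in [B] in place. *)
Lemma partial_inj_extend (I : eqType) (phi : I -> I) (U : seq I) :
  injective phi -> exists psi psi' : I -> I,
  [/\ cancel psi psi', cancel psi' psi, {in U, psi =1 phi} &
      forall x, x \notin U -> x \notin map phi U -> psi x = x].
Proof.
move=> pI; elim: U => [|i U [psi [psi' [K K' eU out]]]]; first by exists id, id.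
have [iU|iU] := boolP (i \in U).
  exists psi, psi'; split=> // [x|x]; first by rewrite in_cons => /orP[/eqP->|]; exact: eU.
  by rewrite /= !in_cons !negb_or => /andP[_ h1] /andP[_ h2]; exact: out.
pose a := psi i; pose b := phi i.
pose sw x := if x == a then b else if x == b then a else x.
have swK : involutive sw.
  move=> x; rewrite /sw; case: (eqVneq x a) => [->|xa].
    by rewrite eqxx; case: eqVneq => [->|].
  case: (eqVneq x b) => [->|xb]; first by rewrite eqxx.
  by rewrite (negPf xa) (negPf xb).
have swE x : x != a -> x != b -> sw x = x.
  by rewrite /sw => /negPf -> /negPf ->.
exists (sw \o psi), (psi' \o sw); split.
- by move=> x /=; rewrite swK K.
- by move=> x /=; rewrite K' swK.
- move=> x; rewrite in_cons /= => /orP[/eqP->|xU]; first by rewrite /sw eqxx.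
  have xi : x != i by apply: contraNneq iU => <-.
  rewrite swE ?eU //; last by rewrite (inj_eq pI).
  by rewrite -eU // (inj_eq (can_inj K)).
- move=> x; rewrite /= !in_cons !negb_or => /andP[xi xU] /andP[xb xpU].
  rewrite /= out // swE //; apply: contra xi => /eqP e.
  by apply/eqP/(can_inj K); rewrite out.
Qed.

Lemma inf_type_enum (I : eqType) (L : seq I) : inf_type I ->
  exists iota : nat -> I, injective iota /\ forall i, i \in L -> exists n, iota n = i.
Proof.
move=> inf; have /choice[f fE] := inf; have [d _] := inf [::].
pose g n := iter n (fun l => rcons l (f l)) (undup L).
have gS n : g n.+1 = rcons (g n) (f (g n)) by [].
have gu n : uniq (g n).
  by elim: n => [|n IH]; rewrite ?undup_uniq // gS rcons_uniq fE.
have gs n : size (g n) = size (undup L) + n.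
  by elim: n => [|n IH]; rewrite ?addn0 // gS size_rcons IH addnS.
have gk n k i : i < size (g n) -> nth d (g (n + k)) i = nth d (g n) i.
  move=> h; elim: k => [|k IH]; first by rewrite addn0.
  by rewrite addnS gS nth_rcons gs ifT // -?IH //; move: h; rewrite gs; lia.
pose iota n := nth d (g n.+1) n.
have iE n m : n < m -> iota n = nth d (g m) n.
  by move=> nm; rewrite -(subnKC nm) gk // gs; lia.
exists iota; split.
  move=> a b; rewrite (@iE a (maxn a b).+1) ?(@iE b (maxn a b).+1); try lia.
  by move=> /eqP; rewrite nth_uniq ?gu ?gs //; try lia; move=> /eqP.
move=> i iL; exists (index i (undup L)).
have h : index i (undup L) < size (undup L) by rewrite index_mem mem_undup.
rewrite /iota -[_.+1]add0n gk; first by rewrite nth_index ?mem_undup.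
by rewrite gs addn0.
Qed.

Section Automorphisms.
Variables (G : groupType) (S : set G) (I : eqType) (v : gvertex I -> G).
Hypotheses (racgS : racg S) (spanS : span S = [set: G]) (parS : param S v).

Let vI : injective v. Proof. by case: parS. Qed.
Let vr : range v = S. Proof. by case: parS. Qed.
Let va x y : adj x y <-> x <> y /\ commute (v x) (v y).
Proof. by case: parS. Qed.
Let Sv x : S (v x). Proof. by rewrite -vr; exists x. Qed.
Let spanT g : span S g. Proof. by rewrite spanS. Qed.

Let comm_adj x y : commute (v x) (v y) -> x = y \/ adj x y.
Proof. by move=> c; have [->|n] := pselect (x = y); [left|right; apply/va]. Qed.

Definition supported (J : set I) (x : gvertex I) := if x is GZ i _ then J i else True.
Definition gens (J : set I) : set G := [set v x | x in supported J].

Lemma gens_sub J : gens J `<=` S.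
Proof. by move=> _ [x _ <-]. Qed.

Lemma gens_mem J x : gens J (v x) <-> supported J x.
Proof. by split=> [[y h /vI <-]|h] //; exists x. Qed.

Lemma gens_mono J J' : J `<=` J' -> gens J `<=` gens J'.
Proof. by move=> sub _ [x h <-]; exists x => //; case: x h => //= i z /sub. Qed.

Lemma span_gens_cap J J' g : span (gens J) g -> span (gens J') g ->
  span (gens (J `&` J')) g.
Proof.
move=> h1 h2; have := span_cap racgS (@gens_sub J) (@gens_sub J') h1 h2.
apply: span_sub => _ [[x hx <-] /gens_mem hx']; apply/gens_mem.
by case: x hx hx' => //= i z.
Qed.

Lemma span_gens_finite (l : seq G) :
  exists U : seq I, forall g, g \in l -> span (gens [set` U]) g.
Proof.
have key (g : G) : exists U : seq I, span (gens [set` U]) g.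
  have [m hm ->] := spanT g; elim: m hm => [_|s m IH].
    by exists [::]; exact: span1.
  move=> /letters_consP[Ss /IH[U hU]]; move: Ss; rewrite -vr => -[x _ <-].
  exists (if x is GZ i _ then i :: U else U); apply: spanM.
    by apply/span_gen/gens_mem; case: x => //= i z; rewrite mem_head.
  apply: span_sub hU; apply: gens_mono => i iU; case: x => //= k z.
  by rewrite /mkset in_cons iU orbT.
elim: l => [|g l [U hU]]; first by exists [::].
have [V hV] := key g; exists (V ++ U) => h; rewrite in_cons => /orP[/eqP->|/hU].
  by apply: span_sub hV; apply: gens_mono => i iV; rewrite /mkset mem_cat iV.
by apply: span_sub; apply: gens_mono => i iU; rewrite /mkset mem_cat iU orbT.
Qed.

Lemma star_GZ j z : star S (v (GZ j z)) `<=` gens [set j].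
Proof.
move=> x []; rewrite -vr => -[y _ <-] /comm_adj h; apply/gens_mem.
by case: h => [->//|]; case: y => //= i w [].
Qed.

Definition conj_std (f : G) :=
  exists g u, span (gens set0) u /\ f = g * u * g^-1.

Lemma clique_nonstd K g : clique S K -> ~ conj_std (g * prodl K * g^-1) ->
  exists j z, v (GZ j z) \in K.
Proof.
move=> [hK _ _] n; apply: contrapT => no; apply: n.
exists g, (prodl K); split=> //; apply: span_prodl => x xK.
have := hK _ xK; rewrite -vr => -[y _ e]; rewrite -e; apply/gens_mem.
case: y e => //= j z e; case: no; exists j, z; by rewrite e.
Qed.

(** By retraction the conjugator of [f] can be taken over copy [j]; the clique then contains a
    letter of that copy, since [f] is not conjugate into the standard part. A conjugate of [h]
    centralizes this letter, whose neighbours are all standard or in copy [j]. *)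
Lemma centralizer_nonstd j f h : span (gens [set j]) f -> f * f = 1 ->
  ~ conj_std f -> commute h f -> span (gens [set j]) h.
Proof.
move=> hf ff nf c; have subj := @gens_sub [set j].
have [g [K [hg cK ef]]] := involution_conj racgS (spanT f) ff.
have := ret_id racgS subj hf.
have [hK uK ccK] := cK.
rewrite {1}ef !(retM racgS) // (retV racgS) // (ret_prodl racgS) //.
set g' := ret _ _ g; set K' := filter _ K => ef'.
have hg' : span (gens [set j]) g'.
  by have := ret_span racgS (gens [set j]) (@subset_refl _ S) hg;
     apply: span_sub => x [].
have cK' : clique S K'.
  split; [|exact: filter_uniq|]; first by move=> x; rewrite mem_filter => /andP[_ /hK].
  by move=> x y; rewrite !mem_filter => /andP[_ xK] /andP[_ yK]; exact: ccK.
have [|i [z kK]] := @clique_nonstd K' g' cK'; first by rewrite ef'.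
have ij : i = j.
  by have := kK; rewrite mem_filter => /andP[/asboolP/gens_mem].
subst i; pose h' := g'^-1 * h * g'.
have ch' : commute h' (prodl K').
  have -> : prodl K' = g'^-1 * f * g' by rewrite -ef' !mulgA mulVg mul1g mulgVK.
  by rewrite /commute /h' !mulgA !mulgK -(mulgA _ h f) c !mulgA.
have ck := centralizer_clique racgS cK' kK (spanT h') ch'.
have sh := centralizer_gen racgS (Sv _) (spanT h') ck.
have -> : h = g' * h' * g'^-1 by rewrite /h' !mulgA mulgV mul1g mulgK.
apply: spanM; last exact: (spanV racgS subj).
by apply: spanM => //; apply: span_sub sh; exact: star_GZ.
Qed.

Section OneAutomorphism.
Variables F F' : G -> G.
Hypotheses (FK : cancel F F') (FK' : cancel F' F) (FM : {morph F : x y / x * y}).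
Hypothesis Fstd : forall x, supported set0 x -> F (v x) = v x.

Lemma morph_cancel : {morph F' : x y / x * y}.
Proof. by move=> x y; apply: (can_inj FK); rewrite FM !FK'. Qed.

Lemma morph1 : F 1 = 1.
Proof. by apply: (@mulgI _ (F 1)); rewrite -FM !mulg1. Qed.

Lemma morphV x : F x^-1 = (F x)^-1.
Proof. by apply/esym/mulg1_eq; rewrite -FM mulgV morph1. Qed.

Lemma morph_commute x y : commute x y -> commute (F x) (F y).
Proof. by rewrite /commute -!FM => ->. Qed.

Lemma morph_sq x : S x -> F x * F x = 1.
Proof. by move=> Sx; rewrite -FM (racg_sq racgS) // morph1. Qed.

Lemma cancel_std x : supported set0 x -> F' (v x) = v x.
Proof. by move=> h; rewrite -{1}(Fstd h) FK. Qed.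

End OneAutomorphism.

Lemma morph_eq_span (f g : G -> G) X : {morph f : x y / x * y} ->
  {morph g : x y / x * y} -> (forall x, X x -> f x = g x) ->
  forall x, span X x -> f x = g x.
Proof.
move=> fM gM e _ [l hl ->]; elim: l hl => [_|x l IH].
  by rewrite /= (morph1 fM) (morph1 gM).
by move=> /letters_consP[Xx /IH el] /=; rewrite fM gM e // el.
Qed.

Lemma morph_span (f : G -> G) X Y : {morph f : x y / x * y} ->
  (forall x, X x -> span Y (f x)) -> forall x, span X x -> span Y (f x).
Proof.
move=> fM e _ [l hl ->]; elim: l hl => [_|x l IH].
  by rewrite /= (morph1 fM); exact: span1.
by move=> /letters_consP[Xx /IH el] /=; rewrite fM; apply: spanM => //; exact: e.
Qed.

(** Otherwise the inverse would make a nonstandard generator conjugate to a standard element,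
    against the conjugation invariance of its parity. *)
Lemma not_conj_std F F' i z : cancel F F' -> cancel F' F ->
  {morph F : x y / x * y} -> (forall x, supported set0 x -> F (v x) = v x) ->
  ~ conj_std (F (v (GZ i z))).
Proof.
move=> FK FK' FM Fs [g [u [hu e]]].
have F'M := morph_cancel FK FK' FM.
have F'u : F' u = u.
  apply: (morph_eq_span (X := gens set0) (g := id)) => //.
  by move=> _ [x hx <-]; exact: (cancel_std FK Fs).
have : chi S (v (GZ i z)) (v (GZ i z)) by rewrite chi_gen // eqxx.
rewrite -{2}(FK (v (GZ i z))) e !F'M (morphV F'M) F'u (chiJ racgS) //.
rewrite (chi_span racgS (@gens_sub set0)) //.
by move=> /gens_mem.
Qed.

Lemma automorphism_copy F F' i : cancel F F' -> cancel F' F ->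
  {morph F : x y / x * y} -> (forall x, supported set0 x -> F (v x) = v x) ->
  exists j, forall z, span (gens [set j]) (F (v (GZ i z))).
Proof.
move=> FK FK' FM Fs.
pose f z := F (v (GZ i z)).
have nf z : ~ conj_std (f z) by exact: not_conj_std FK FK' FM Fs.
have ff z : f z * f z = 1 by exact: morph_sq.
have fc z w : adj (GZ i z) (GZ i w) -> commute (f z) (f w).
  by move=> /va[_ c]; exact: morph_commute.
pose Y n : set G := [set v x | x in [set x | if x is GZ _ z then n <= absz z else false]].
have YS n : Y n `<=` S by move=> _ [x _ <-].
have fY n : 3 <= n -> span (Y n) (f (Posz n)).
  move=> n3; have cm m : m <= n -> span (star S (v (GN m))) (f (Posz n)).
    move=> mn; apply: (centralizer_gen racgS) => //.
    have /va[_ c] : adj (GZ i (Posz n)) (GN m) by [].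
    by rewrite -(Fs (GN m)) //; exact: morph_commute.
  have h0 := cm 0 (leq0n _); have h3 := cm 3 n3; have hn := cm n (leqnn _).
  have sub m : star S (v (GN m)) `<=` S by exact: star_sub.
  have h03 := span_cap racgS (sub 0) (sub 3) h0 h3.
  have sub2 : star S (v (GN 0)) `&` star S (v (GN 3)) `<=` S by move=> x [/sub].
  have := span_cap racgS sub2 (sub n) h03 hn; apply: span_sub.
  move=> x [[[]]]; rewrite -{1}vr => -[y _ <-] /comm_adj a0 [_ /comm_adj a3] [_ /comm_adj an].
  (* The numbers 0 and 3 are not adjacent and have no common neighbour in the standard part, so a
     letter commuting with both lies in a copy; commuting with [n] then bounds its level from
     below. *)
  exists y => //; case: y a0 a3 an => [c|m|k z] /=.
  - by case=> // h0'; case=> // h3'; move: h0' h3'; case: c.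
  - by case=> [[->]|h0']; case=> [[h3']|h3'] //; move: h0' h3'; lia.
  - by move=> _ _ [|].
have [g [K [hg cK ef]]] := involution_conj racgS (spanT (f 3)) (ff 3).
have [|j [z0 kK]] := @clique_nonstd K g cK; first by rewrite -ef; exact: nf.
have [hK uK ccK] := cK.
have conjE x y : g^-1 * (x * y) * g = (g^-1 * x * g) * (g^-1 * y * g).
  by rewrite !mulgA mulgK.
have conjC x y : commute x y -> commute (g^-1 * x * g) (g^-1 * y * g).
  by move=> c; rewrite /commute -!conjE c.
have nfg z : ~ conj_std (g^-1 * f z * g).
  move=> [h [u [hu e]]]; apply: (nf z); exists (g * h), u; split=> //.
  have -> : f z = g * (g^-1 * f z * g) * g^-1 by rewrite !mulgA mulgV mul1g mulgK.
  by rewrite e invgM !mulgA.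
(* Consecutive images commute, so [centralizer_nonstd] carries the confinement from level 3 upwards,
   still conjugated by [g]. *)
have gfn n : span (gens [set j]) (g^-1 * f (Posz (n + 3)) * g).
  elim: n => [|n IH].
    rewrite -[Posz (0 + 3)]/(Posz 3) ef !mulgA mulVg mul1g mulgVK; apply: span_prodl => x xK.
    by apply: (@star_GZ j z0); split; [exact: hK|exact: ccK].
  apply: (centralizer_nonstd IH _ (nfg _)).
    by rewrite -conjE ff mulg1 mulVg.
  apply: conjC; apply: fc; split=> //.
  by have -> : (Posz (n.+1 + 3) == Posz (n + 3) + 1)%R by lia.
(* A word for [g] has finitely many letters, so retracting beyond their levels kills [g]. *)
have [n hn] : exists n, forall m, n <= m -> ret S (Y m) g = 1.
  have [l hl ->] := hg.
  have [n hn] : exists n, forall k z, v (GZ k z) \in l -> absz z < n.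
    elim: l hl => [_|s l IH]; first by exists 0.
    move=> /letters_consP[Ss /IH[n hn]]; move: Ss; rewrite -vr => -[x _ <-].
    exists (n + (if x is GZ _ z then (absz z).+1 else 0)) => k z.
    rewrite in_cons => /orP[/eqP/vI <-|/hn]; lia.
  exists n => m nm; rewrite (ret_prodl racgS) //.
  rewrite (_ : filter _ _ = [::]) //; apply/eqP; rewrite -[_ == _]negbK -has_filter.
  apply/hasPn => x xl; apply/asboolP => -[[c|k|k z] //= hz e].
  by have := hn k z; rewrite e => /(_ xl); lia.
(* [fY] needs level at least 3, and [gfn] starts there. *)
pose N := n + 3.
have fN : span (gens [set j]) (f (Posz N)).
  have hr := gfn n; set r := g^-1 * _ * g in hr.
  have efr : f (Posz N) = g * r * g^-1.
    by rewrite /r !mulgA mulgV mul1g mulgK.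
  clearbody r; have := ret_id racgS (@YS N) (fY N (leq_addl _ _)).
  rewrite {1}efr !(retM racgS) // (retV racgS) // hn ?leq_addr // mul1g invg1 mulg1 => <-.
  have := ret_span racgS (Y N) (@gens_sub [set j]) hr.
  by apply: span_sub => x [].
(* From level [N] the confinement, now without conjugation, spreads along the copy in both
   directions. *)
have step z w : adj (GZ i z) (GZ i w) -> span (gens [set j]) (f z) -> span (gens [set j]) (f w).
  move=> a hz; apply: (centralizer_nonstd hz) => //.
  by apply: fc; exact: adj_sym.
have up m : span (gens [set j]) (f (Posz N + Posz m)%R).
  elim: m => [|m IH]; first by rewrite GRing.addr0.
  by apply: step IH; split=> //; lia.
have dn m : span (gens [set j]) (f (Posz N - Posz m)%R).
  elim: m => [|m IH]; first by rewrite GRing.subr0.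
  by apply: step IH; split=> //; lia.
exists j => z; have [h|h] : (Posz N <= z)%R \/ (z <= Posz N)%R by lia.
  have -> : z = (Posz N + Posz (absz (z - Posz N)))%R by lia.
  exact: up.
have -> : z = (Posz N - Posz (absz (z - Posz N)))%R by lia.
exact: dn.
Qed.

(** An edge leaving a copy ends in the standard part, which is fixed both by [F] and by relabelling.
    So every commutation relation is checked under a single rule. *)
Lemma hybrid_morph (F : G -> G) (U : pred I) (psi : I -> I) :
  {morph F : x y / x * y} -> (forall x, supported set0 x -> F (v x) = v x) ->
  injective psi ->
  exists2 P : G -> G, {morph P : x y / x * y} &
    forall x, P (v x) = if x is GZ i _ then if U i then F (v x) else v (relabel psi x)
                        else v x.
Proof.
move=> FM Fs psiI.
have /choice[w wE] : forall g, exists x, S g -> v x = g.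
  move=> g; have [|n] := pselect (S g); last by exists (GN 0).
  by rewrite -vr => -[x _ e]; exists x.
pose p x := if x is GZ i _ then if U i then F (v x) else v (relabel psi x) else v x.
have pcomm x y : adj x y -> commute (p x) (p y).
  move=> a; have [_ c] := proj1 (va _ _) a.
  have cF := morph_commute FM c.
  have cr : commute (v (relabel psi x)) (v (relabel psi y)).
    by have /(adj_relabel _ _ psiI)/va[] := a.
  case: x y a c cF cr => [c|n|i z] [d|m|j w'] //= a c0 cF cr.
  - by case: ifP => // _; rewrite -(Fs (GC c)).
  - by case: ifP => // _; rewrite -(Fs (GN n)).
  - by case: ifP => // _; rewrite -(Fs (GC d)).
  - by case: ifP => // _; rewrite -(Fs (GN m)).
  - by move: a => [e _]; subst j; case: ifP.
have [||P PM PE] := @racg_hom G S racgS G (fun g => p (w g)).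
- move=> s Ss; rewrite /p; case: (w s) => [c|n|i z]; try exact: (racg_sq racgS).
  by case: ifP => _; [exact: morph_sq|exact: (racg_sq racgS)].
- move=> s t Ss St; rewrite -{1}(wE _ Ss) -{1}(wE _ St) => /comm_adj[->|/pcomm//].
  exact: commute_refl.
exists P; first by move=> x y; exact: PM.
by move=> x; rewrite PE //; have /vI -> := wE _ (Sv x).
Qed.

Lemma automorphism_local (F : G -> G) (JA JB : set I) (a b : seq G) (U V : seq I) :
  automorphism F -> JA `<=` JB -> (forall x, span (gens JA) x -> F x = x) ->
  map F a = b ->
  (forall g, g \in a -> span (gens [set` U]) g) ->
  (forall g, g \in b -> span (gens [set` V]) g) ->
  (forall i, i \in U ++ V -> JB i -> JA i) ->
  same_type (span (gens JB)) a b.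
Proof.
move=> [[F' FK FK'] FM] sAB FA Fab hU hV UV.
have FAg x : supported JA x -> F (v x) = v x.
  by move=> h; apply/FA/span_gen/gens_mem.
have Fs x : supported set0 x -> F (v x) = v x.
  by move=> h; apply: FAg; case: x h.
have F's x : supported set0 x -> F' (v x) = v x by exact: cancel_std.
have F'M := morph_cancel FK FK' FM.
have /choice[phi hphi] := fun i => automorphism_copy i FK FK' FM Fs.
have /choice[phi' hphi'] := fun i => automorphism_copy i FK' FK F'M F's.
have gens1 (J : set I) i : J i -> gens [set i] `<=` gens J.
  by move=> Ji; apply: gens_mono => _ ->.
have spanJ (H : G -> G) (h : I -> I) : {morph H : x y / x * y} ->
    (forall x, supported set0 x -> H (v x) = v x) ->
    (forall i z, span (gens [set h i]) (H (v (GZ i z)))) ->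
    forall J x, span (gens J) x -> span (gens (h @` J)) (H x).
  move=> HM Hs hh J; apply: morph_span => // _ [x hx <-].
  case: x hx => [c|n|i z] hx.
  - by rewrite Hs //; exact/span_gen/gens_mem.
  - by rewrite Hs //; exact/span_gen/gens_mem.
  - by apply: span_sub (hh i z); apply: gens1; exists i.
have spanF := spanJ F phi FM Fs hphi.
have spanF' := spanJ F' phi' F'M F's hphi'.
have mem1 i j z : span (gens [set j]) (v (GZ i z)) -> i = j.
  by move=> /(span_mem racgS (@gens_sub _) (Sv _))/gens_mem.
have phiK : cancel phi phi'.
  move=> i; apply/esym; apply: (@mem1 _ _ 0%R).
  have := spanF' _ _ (hphi i 0%R); rewrite FK; apply: span_sub.
  by apply: gens_mono => _ [_ -> <-].
have phiK' : cancel phi' phi.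
  move=> i; apply/esym; apply: (@mem1 _ _ 0%R).
  have := spanF _ _ (hphi' i 0%R); rewrite FK'; apply: span_sub.
  by apply: gens_mono => _ [_ -> <-].
have phiA i : JA i -> phi i = i.
  by move=> Ji; apply/esym; apply: (@mem1 _ _ 0%R); rewrite -(FAg (GZ i 0)).
(* The images under [F] of the entries of [a] are supported both on the [phi]-image of [U] and on
   [V]; pulling back confines [a] to these copies. *)
pose U' := [seq i <- U | phi i \in V].
have hU' g : g \in a -> span (gens [set` U']) g.
  move=> ga; have Fgb : F g \in b by rewrite -Fab map_f.
  have h1 := spanF _ _ (hU g ga); have := span_gens_cap h1 (hV _ Fgb).
  move=> /spanF'; rewrite FK; apply: span_sub; apply: gens_mono.
  move=> _ [_ [[i iU <-] /= pV] <-]; rewrite phiK /mkset mem_filter pV; exact: iU.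
pose U1 := [seq i <- U' | ~~ `[<JB i>]].
have U1P i : (i \in U1) = [&& ~~ `[<JB i>], phi i \in V & i \in U].
  by rewrite !mem_filter.
have [psi [psi' [K K' eU out]]] := partial_inj_extend U1 (can_inj phiK).
have [P PM PE] := @hybrid_morph F (fun i => i \in U1) psi FM Fs (can_inj K).
have [P' P'M P'E] := @hybrid_morph F' (fun i => i \in map phi U1) psi' F'M F's (can_inj K').
have PF i x : i \in U1 -> span (gens [set i]) x -> P x = F x.
  move=> iU; apply: morph_eq_span => // _ [y hy <-]; rewrite PE.
  case: y hy => [c|n|k z] hy; [by rewrite Fs|by rewrite Fs|].
  by move: hy => /= ->; rewrite iU.
have P'F i x : i \in map phi U1 -> span (gens [set i]) x -> P' x = F' x.
  move=> iU; apply: morph_eq_span => // _ [y hy <-]; rewrite P'E.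
  case: y hy => [c|n|k z] hy; [by rewrite F's|by rewrite F's|].
  by move: hy => /= ->; rewrite iU.
have all_id (H : G -> G) : {morph H : x y / x * y} -> (forall x, H (v x) = v x) ->
    forall x, H x = x.
  move=> HM Hv x; apply: (morph_eq_span (X := S) (g := id)) => //.
  by rewrite -vr => _ [y _ <-].
have PK : cancel P P'.
  apply: (all_id (P' \o P)) => [x y|x] /=; first by rewrite PM P'M.
  rewrite PE; case: x => [c|n|i z]; try by rewrite P'E.
  case: ifP => [iU|iU].
    by rewrite (@P'F (phi i)) ?FK //; exact: map_f.
  rewrite P'E /= ifF ?K //; apply/negP => /mapP[u uU].
  by rewrite -eU // => /(can_inj K) e; rewrite e uU in iU.
have P'K : cancel P' P.
  apply: (all_id (P \o P')) => [x y|x] /=; first by rewrite P'M PM.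
  rewrite P'E; case: x => [c|n|i z]; try by rewrite PE.
  case: ifP => [/mapP[u uU ->]|iU].
    by rewrite (@PF u) ?FK' // -{1}(phiK u).
  rewrite PE /= ifF ?K' //; apply/negP => uU.
  by move/negP: iU; apply; apply/mapP; exists (psi' i); rewrite // -eU ?K'.
have PB x : supported JB x -> P (v x) = v x.
  rewrite PE; case: x => // i z /= Ji.
  have iU : i \notin U1 by rewrite U1P; move/asboolP: Ji => ->.
  rewrite ifF; last exact/negP/negP.
  rewrite out //; apply/mapP => -[u uU e].
  (* If a copy in [JB] were [phi u] with [u] in [U1], it would lie in [V], hence in [JA], and be
     fixed by [phi]; so [u] itself would be in [JB]. *)
  move: (uU); rewrite U1P => /and3P[/asboolPn nu pV _].
  have JAp : JA (phi u) by apply: UV; rewrite ?mem_cat ?pV ?orbT // -e.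
  by apply: nu; have /(can_inj phiK) := phiA _ JAp => <-; exact: sAB.
exists P; split; first by split=> //; exists P'.
- move=> x; apply: (morph_eq_span (g := id)) => // _ [y hy <-]; exact: PB.
- rewrite -Fab; apply/eq_in_map => g /hU'; apply: morph_eq_span => // _ [x hx <-].
  case: x hx => [c|n|i z] hx; try by rewrite PB // Fs.
  (* A copy in [JB] met by [a] belongs to [JA], where [F] is already the identity. *)
  have [JBi|nJB] := pselect (JB i).
    rewrite PB // FAg //; apply: UV => //; rewrite mem_cat.
    by move: hx; rewrite /= /mkset mem_filter => /andP[_ ->].
  apply: (@PF i); last by apply/span_gen/gens_mem.
  by rewrite mem_filter hx andbT; apply/asboolPn.
Qed.

End Automorphisms.

(** * Tameness *)

Lemma countable_span (G : groupType) (I : Type) (v : gvertex I -> G) (f : I -> nat) :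
  injective f -> countable (span (range v)).
Proof.
move=> fI; pose c x := pickle (code x, if x is GZ i _ then f i else 0).
have cI : injective c.
  move=> x y /(pcan_inj pickleK); case: x y => [d|n|i z] [d'|m|j w] //= [].
  - by case: d d' => [] [].
  - by move=> ->.
  - by move=> -> /fI ->.
have /choice[d dE] : forall n, exists g, forall x, c x = n -> v x = g.
  move=> n; have [[x e]|no] := pselect (exists x, c x = n).
    by exists (v x) => y e'; congr v; apply: cI; rewrite e e'.
  by exists 1 => x e; case: no; exists x.
have sub : span (range v) `<=` range (fun w : seq nat => prodl (map d w)).
  move=> _ [l hl ->]; elim: l hl => [_|x l IH]; first by exists [::].
  move=> /letters_consP[[y _ <-] /IH[w _ e]].
  by exists (c y :: w) => //=; rewrite -(dE _ y) // e.
apply: (@sub_countable _ _ _ (range (fun w : seq nat => prodl (map d w)))).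
  exact: subset_card_le.
apply: (@sub_countable _ _ _ [set: seq nat]); first exact: card_image_le.
exact: countableP.
Qed.

Lemma uncountable_inf_type (I : eqType) :
  (~ exists f : I -> nat, injective f) -> inf_type I.
Proof.
move=> unc L; apply: contrapT => no; apply: unc.
have inL i : i \in L by apply: contrapT => /negP iL; apply: no; exists i.
exists (index^~ L) => i j /(congr1 (nth i L)).
by rewrite !nth_index.
Qed.

Lemma subgroup_span (G : groupType) (S X : set G) : racg S -> X `<=` S ->
  subgroup (span X).
Proof.
move=> rS sub; split; [exact: span1|by move=> x y; exact: spanM|].
by move=> x; exact: (spanV rS sub).
Qed.

(** The copies are indexed by their origins; [{classic _}] supplies the decidable equality needed
    for lists of copies. *)
Lemma K2_param (G : groupType) (H : set G) : K2 H ->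
  exists (S : set G) (B : sstruct) (O : set B) (v : gvertex {classic {o | O o}} -> G),
  [/\ Coxeter_basis H S, models B (Th nat_sstruct), is_origins O & param S v].
Proof.
move=> [_ [S [bS [B [O [mB oO iso]]]]]].
have Oo : O = range (@sval _ O).
  by apply/seteqP; split=> [x Ox|_ [x _ <-]]; [exists (exist _ x Ox)|exact: svalP].
have [v pv] := proj1 (iso_param mB oO (@sval_injective _ O) Oo S) iso.
by exists S, B, O, v.
Qed.

Lemma param_K2 (G : groupType) (H S : set G) (v : gvertex nat -> G) :
  models (zmodel nat) (Th nat_sstruct) -> Coxeter_basis H S -> subgroup H ->
  param S v -> K2 H.
Proof.
move=> mN bS sH pv; split=> //; exists S; split=> //.
exists (zmodel nat), (range (fun i : nat => inr (i, 0%R))).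
have oN := @zmodel_origins nat; split=> //.
by apply/(@iso_param _ mN _ _ (fun i => inr (i, 0%R)) oN) => //; [move=> i j []|exists v].
Qed.

Theorem theorem6p3 : tame K2.
Proof.
move=> M [KM _ _] B infB [KB _ [sgB _ _ [S [bS bT]]]] a b nst.
have [cB|ncB] := pselect (countable B).
  exists B; split=> //; split=> //; split=> //.
  have [_ [T [bT' _]]] := KB; exists T; split=> //.
  have [_ eB] := Coxeter_basis_racg bT'.
  suff -> : B `&` T = T by [].
  by apply/seteqP; split=> [x []//|x Tx]; split=> //; rewrite eB; exact: span_gen.
have [S1 [B1 [O1 [v1 [bS1 mB1 oO1 pv1]]]]] := K2_param KM.
have [T1 [B0 [O0 [v0 [bT1 mB0 oO0 pv0]]]]] := K2_param KB.
have [rS eM] := Coxeter_basis_racg bS; have [rS1 eM1] := Coxeter_basis_racg bS1.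
have [rT eB] := Coxeter_basis_racg bT; have [rT1 eB1] := Coxeter_basis_racg bT1.
have unc0 : ~ exists f : {classic {o | O0 o}} -> nat, injective f.
  move=> [f fI]; apply: ncB; rewrite eB1; have [_ <- _] := pv0.
  exact: countable_span fI.
have unc1 : ~ exists f : {classic {o | O1 o}} -> nat, injective f.
  move=> [f fI]; apply: ncB.
  apply: (@sub_countable _ _ _ [set: M]); first exact: subset_card_le.
  by rewrite eM1; have [_ <- _] := pv1; exact: countable_span fI.
have inh (T : Type) : (~ exists f : T -> nat, injective f) -> inhabited T.
  move=> unc; apply: contrapT => ni; apply: unc.
  by exists (fun=> 0) => x; case: ni; exact: (inhabits x).
(* The basis [S] need not be [S1], nor its part in [B] be [T1]; rigidity transports the two graph
   structures to [S] and to its part in [B]. *)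
have [|v pv] := param_rigid (inh _ unc1) rS1 rS _ pv1; first by rewrite -eM1.
have [|w pw] := param_rigid (inh _ unc0) rT1 rT _ pv0; first by rewrite -eB1.
have [vI vr va] := pv; have [wI wr wa] := pw.
have /choice[j jE] : forall x, exists y, v y = w x.
  move=> x; have [_ Sw] : (B `&` S) (w x) by rewrite -wr; exists x.
  by move: Sw; rewrite -vr => -[y _ e]; exists y.
have jI : injective j by move=> x y e; apply: wI; rewrite -!jE e.
have jA x y : adj x y <-> adj (j x) (j y).
  rewrite wa va !jE; split=> -[n c]; split=> // e; apply: n; last by rewrite e.
  exact: jI.
have [jC jN] := embed_std jI jA unc0.
have [theta [thI [jZ jZ']]] := embed_theta jI jA unc0.
pose JB : set {classic {o | O1 o}} := range theta.
have eT : B `&` S = gens v JB.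
  rewrite -wr; apply/seteqP; split=> [_ [x _ <-]|_ [x hx <-]].
    rewrite -jE; apply/(gens_mem pv); case: x => [c|n|i z].
    - by rewrite jC.
    - by rewrite jN.
    - by have [z' -> _] := jZ i z; exists i.
  case: x hx => [c|n|k z] /=.
  - by move=> _; exists (GC c) => //; rewrite -jE jC.
  - by move=> _; exists (GN n) => //; rewrite -jE jN.
  - move=> [i _ <-]; have [z' e] := jZ' i z.
    by exists (GZ i z') => //; rewrite -jE e.
have spS : span S = [set: M] by rewrite -eM.
have [U hU] := span_gens_finite spS pv a.
have [V hV] := span_gens_finite spS pv b.
(* The finitely many copies of [B] that meet [a] or [b], indexed within [B]; the enumeration [iota]
   has to include them. *)
have [L0 hL0] : exists L0 : seq {classic {o | O0 o}},
    forall i, i \in U ++ V -> JB i -> exists2 x, x \in L0 & theta x = i.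
  elim: (U ++ V) => [|k L [L0 IH]]; first by exists [::].
  have [[x _ e]|nk] := pselect (JB k).
    exists (x :: L0) => i; rewrite in_cons => /orP[/eqP-> _|iL Ji].
      by exists x; rewrite ?mem_head.
    by have [y yL ey] := IH i iL Ji; exists y; rewrite // in_cons yL orbT.
  by exists L0 => i; rewrite in_cons => /orP[/eqP->|] //; exact: IH.
have inf0 := uncountable_inf_type unc0.
have [iota [iI iL]] := inf_type_enum L0 inf0.
pose JA : set {classic {o | O1 o}} := range (theta \o iota).
have sAB : JA `<=` JB by move=> _ [n _ <-]; exists (iota n).
have UV i : i \in U ++ V -> JB i -> JA i.
  by move=> iUV /(hL0 i iUV)[x /iL[n <-] <-]; exists n.
have gAS : gens v JA `<=` S by exact: (@gens_sub _ _ _ _ pv).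
have bA : Coxeter_basis (span (gens v JA)) (gens v JA) by exact: Coxeter_basis_sub bS gAS.
have sgA : subgroup (span (gens v JA)) by exact: subgroup_span rS gAS.
have mN : models (zmodel nat) (Th nat_sstruct).
  exact: (zmodel_models inf0 inf_nat (models_zmodel mB0 oO0)).
have tiI : injective (theta \o iota) by move=> n m /thI/iI.
pose rl := relabel (theta \o iota); have rlI : injective rl := relabel_inj tiI.
have rl_range : range (v \o rl) = gens v JA.
  apply/seteqP; split=> [_ [x _ <-]|_ [x hx <-]].
    by exists (rl x) => //; case: x => //= n z; exists n.
  case: x hx => [c|n|k z] /=; try by [exists (GC c)|exists (GN n)].
  by move=> [n _ <-]; exists (GZ n z).
have KA : K2 (span (gens v JA)).
  apply: (param_K2 (v := v \o rl) mN bA sgA); split=> // [x y /vI/rlI//|x y].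
  rewrite (adj_relabel x y tiI) va.
  by split=> -[n c]; split=> // e; apply: n; rewrite ?e //; exact: rlI.
exists (span (gens v JA)); split.
- by rewrite -rl_range; exact: (@countable_span _ _ _ id).
- split=> //; split=> //.
    by rewrite eB eT; apply: span_sub; exact: gens_mono.
  exists (B `&` S); split=> //.
  suff -> : span (gens v JA) `&` (B `&` S) = gens v JA by [].
  apply/seteqP; split=> [x [hx [_ Sx]]|x hx].
    exact: (span_mem rS gAS Sx).
  by split; [exact: span_gen|rewrite eT; exact: gens_mono hx].
- move=> [F [aF FA Fab]]; apply: nst; rewrite eB eT.
  exact: (automorphism_local rS spS pv aF sAB FA Fab hU hV UV).
Qed.
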